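(* Let $d,q,s$ be positive integers and let $M\ge\max\{2q+1,\,9\cdot4^d\cdot d^2\cdot s^2\}$ be a prime number. Let $m=\lfloor M/2\rfloor+1$ and $\mathbf x_j=\cos(\mathbf p_j)$ (componentwise), $\mathbf p_j=2\pi(j,j^2,\ldots,j^d)/M$, $j=0,\ldots,m-1$. Let $f=\sum_{\mathbf n\in\Lambda_{\mathbf P}^{q,d}}c_{\mathbf n}\mathbf\Phi_{\mathbf n}$ with $\mathbf c=(c_{\mathbf n})\in\mathbb{C}^{(q+1)^d}$. Let $\mathbf A=\mathbf A_{\mathbf P}\mathbf C$, where $\mathbf A_{\mathbf P}=[\mathbf\Phi_{\mathbf n}(\mathbf x_j)]_{j=0,\ldots,m-1;\ \mathbf n\in\Lambda_{\mathbf P}^{q,d}}$ and $\mathbf C$ is the diagonal matrix for which every column of $\mathbf A$ has unit $\ell_2$ norm, let $\mathbf b=(f(\mathbf x_0),\ldots,f(\mathbf x_{m-1}))^\top$, and let $\mathbf c^\#$ be a solution of $\min\{\|\mathbf z\|_1:\mathbf z\in\mathbb{C}^{(q+1)^d},\ \mathbf A\mathbf z=\mathbf b\}$. Then, with $\tilde{\mathbf c}=\mathbf C^{-1}\mathbf c$, there is a constant $K>0$ not depending on $\mathbf c$ such that $$\|\mathbf c^\#-\tilde{\mathbf c}\|_2\le K\,\frac{\sigma_{s,1}(\tilde{\mathbf c})}{\sqrt s}.$$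
   Context: $\mathbb N=\{0,1,2,\ldots\}$, $\Lambda_{\mathbf P}^{q,d}=\{\mathbf n\in\mathbb N^d:\max_j n_j\le q\}$, and $\mathbf\Phi_{\mathbf n}(\mathbf x)=\prod_{t=1}^d\cos(n_t\arccos x_t)$ for $\mathbf x\in[-1,1]^d$. For $\mathbf v\in\mathbb{C}^N$, $\sigma_{s,1}(\mathbf v)=\min\{\|\mathbf v-\mathbf z\|_1:\mathbf z\in\mathbb{C}^N,\ \mathbf z\text{ has at most }s\text{ nonzero entries}\}$. *)

(* Defs.v *)
From mathcomp Require Import all_boot all_order all_algebra.
From mathcomp Require Import all_classical all_reals all_analysis.
From mathcomp Require Import complex.
Unset Strict Implicit. Unset Printing Implicit Defensive.
Import Order.TTheory GRing.Theory Num.Theory.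
Local Open Scope ring_scope.
Local Open Scope classical_set_scope.
Local Open Scope complex_scope.

Section Defs.
Variable R : realType.

Definition Lam (q d : nat) := {ffun 'I_d -> 'I_q.+1}.

Definition cmod (z : R[i]) : R :=
  let: Complex a b := z in Num.sqrt (a ^+ 2 + b ^+ 2).

Definition Phi (q d : nat) (n : Lam q d) (x : 'I_d -> R) : R :=
  \prod_(t < d) cos ((n t)%:R * acos (x t)).

Definition msz (M : nat) : nat := (M./2).+1.

Definition ppt (M d j : nat) (t : 'I_d) : R :=
  2 * pi * (expn j t.+1)%:R / M%:R.
Definition xpt (M d j : nat) (t : 'I_d) : R := cos (ppt M d j t).

Definition AP (M q d : nat) (j : 'I_(msz M)) (n : Lam q d) : R :=
  Phi q d n (xpt M d j).

(* diagonal entries of C: inverse l2 norms of the columns of A_P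
   (so that every column of A = A_P C has unit l2 norm) *)
Definition Cdiag (M q d : nat) (n : Lam q d) : R :=
  (Num.sqrt (\sum_(j < msz M) AP M q d j n ^+ 2))^-1.

Definition Amat (M q d : nat) (j : 'I_(msz M)) (n : Lam q d) : R :=
  AP M q d j n * Cdiag M q d n.

Definition Amul (M q d : nat) (z : Lam q d -> R[i]) (j : 'I_(msz M)) : R[i] :=
  \sum_(n : Lam q d) (Amat M q d j n)%:C * z n.

Definition fexp (q d : nat) (c : Lam q d -> R[i]) (x : 'I_d -> R) : R[i] :=
  \sum_(n : Lam q d) c n * (Phi q d n x)%:C.

Definition bvec (M q d : nat) (c : Lam q d -> R[i]) (j : 'I_(msz M)) : R[i] :=
  fexp q d c (xpt M d j).

Definition ctil (M q d : nat) (c : Lam q d -> R[i]) (n : Lam q d) : R[i] :=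
  c n / (Cdiag M q d n)%:C.

Definition l1norm (T : finType) (v : T -> R[i]) : R := \sum_(i : T) cmod (v i).
Definition l2norm (T : finType) (v : T -> R[i]) : R :=
  Num.sqrt (\sum_(i : T) cmod (v i) ^+ 2).

Definition sigma1 (T : finType) (s : nat) (v : T -> R[i]) : R :=
  inf [set r : R | exists z : T -> R[i],
         (#|[pred i | z i != 0%R]| <= s)%N /\ r = l1norm T (fun i => v i - z i)].

End Defs.

(* Main.v *)
(* The l1 minimiser is controlled by the coherence of the normalised matrix: if
   h = c^# - c~ lies in the kernel of A, each coordinate satisfies
   3s |h_n| <= ||h||_1, which is the null space property of order s with room to
   spare, and the constant 6 works.

   Expanding products of cosines into additive characters of F_M, the entries of
   the Gram matrix become averages of sums of psi(f(j)) over j in F_M with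
   f of degree D <= d, so the coherence bound follows from Weil's inequality
   |sum_j psi(f(j))| <= (D - 1) sqrt M.

   Weil's inequality is obtained as follows, K being an algebraic closure of F_p
   and S_k the sum of psi(Tr f(x)) over x in F_{p^k}.
   - The function chi(g) = psi(sum of f over the roots of g) is multiplicative on
     monic polynomials over F_p, and its sums c_n over degree n vanish for n >= D.
     Counting the roots of g through norms of linear factors gives
     n c_n = sum_{k=1}^n S_k c_{n-k}, hence S_k = - sum_i omega_i^k with D - 1
     complex numbers omega_i (rationality of the L-function).
   - Stepanov's method bounds the number of x in F_q, q = p^{2m}, with
     Tr f(x) = a by q/p + O(sqrt q), hence S_{2m} = O(p^m), which forces
     |omega_i| <= sqrt p. *)

Require Import Defs.
From mathcomp Require Import all_boot all_order all_algebra all_field.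
From mathcomp Require Import all_classical all_reals all_analysis.
From mathcomp Require Import complex.
From mathcomp Require Import zify ring lra.
Set Implicit Arguments. Unset Strict Implicit. Unset Printing Implicit Defensive.
Import Order.TTheory GRing.Theory Num.Theory.
Local Open Scope ring_scope.

(** * Stepanov's bound *)

(** The coefficient matrix has more rows than columns, hence a nonzero left kernel vector. *)
Lemma poly_lin_relation (F : fieldType) (I : finType) (n : nat)
    (P : I -> {poly F}) :
  (forall i, size (P i) <= n)%N -> (n < #|I|)%N ->
  exists2 e : I -> F, exists i, e i != 0 & \sum_i e i *: P i = 0.
Proof.
move=> sP ltn; pose A : 'M[F]_(#|I|, n) := \matrix_(i, j) (P (enum_val i))`_j.
have : kermx A != 0.
  rewrite -mxrank_eq0 mxrank_ker subn_eq0 -ltnNge.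
  exact: leq_ltn_trans (rank_leq_col A) ltn.
case/rowV0Pn => v /sub_kermxP vA v0.
exists (fun i => v 0 (enum_rank i)).
  have /existsP[j vj] : [exists j, v 0 j != 0].
    apply: contraNT v0 => /existsPn h; apply/eqP/rowP => j.
    by rewrite mxE; apply/eqP; rewrite -[_ == _]negbK h.
  by exists (enum_val j); rewrite enum_valK.
apply/polyP => k; rewrite coef_sum coef0.
have [kn|nk] := ltnP k n; last first.
  by apply: big1 => i _; rewrite coefZ nth_default ?mulr0 // (leq_trans (sP i)).
have := congr1 (fun B : 'rV[F]_n => B 0 (Ordinal kn)) vA.
rewrite !mxE => vk; rewrite -[RHS]vk [RHS](reindex enum_rank) /=; last first.
  by apply: onW_bij; apply: enum_rank_bij.
by apply: eq_bigr => i _; rewrite mxE enum_rankK coefZ.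
Qed.

(** Among the terms with nonzero coefficient, the one of largest size cannot be cancelled. *)
Lemma sum_poly_neq0 (F : fieldType) (I : finType) (P : I -> {poly F}) e :
  (forall i, P i != 0) -> injective (fun i => size (P i)) ->
  (exists i, e i != 0) -> \sum_i e i *: P i != 0.
Proof.
move=> P0 injP [i0 ei0].
case: (@arg_maxnP _ i0 (fun i => e i != 0) (fun i => size (P i)) ei0) => i1 ei1 max1.
apply/eqP => /(congr1 (fun q : {poly F} => q`_(size (P i1)).-1)).
rewrite coef_sum coef0 (bigD1 i1) //= big1 => [|i ii1]; last first.
  rewrite coefZ; have [->|ei] := eqVneq (e i) 0; first by rewrite mul0r.
  rewrite nth_default ?mulr0 //.
  have /= := max1 i ei; rewrite [X in is_true X -> _]leq_eqVlt => /orP[/eqP/injP/eqP|];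
    first by rewrite (negbTE ii1).
  by case: (size (P i1)).
by apply/eqP; rewrite addr0 coefZ mulf_neq0 // -lead_coefE lead_coef_eq0.
Qed.

Lemma sum_expr_pchar (A : comNzRingType) (p k : nat) (I : Type) (r : seq I)
    (P : pred I) (F : I -> A) : p \in [pchar A] ->
  (\sum_(i <- r | P i) F i) ^+ (p ^ k) = \sum_(i <- r | P i) F i ^+ (p ^ k).
Proof.
move=> cp; apply: (big_morph (fun x => x ^+ (p ^ k))) => [x y|].
  by rewrite exprDn_pchar // pnatX; apply/orP; left; rewrite pnatE ?(pcharf_prime cp).
by rewrite expr0n expn_eq0 (gtn_eqF (prime_gt0 (pcharf_prime cp))).
Qed.

Lemma size_exp_neq0 (A : idomainType) (f : {poly A}) n :
  f != 0 -> size (f ^+ n) = ((size f).-1 * n).+1.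
Proof. by move=> f0; rewrite polySpred ?expf_neq0 // size_exp. Qed.

Section Stepanov.
Variables (K : closedFieldType) (p : nat).
Hypothesis charKp : p \in [pchar K].

Let p_pr : prime p := pcharf_prime charKp.
Let p_gt1 : (1 < p)%N := prime_gt1 p_pr.

(** On the field with [p ^ k] elements this is the trace to F_p. *)
Definition powtrace (k : nat) (y : K) : K := \sum_(i < k) y ^+ (p ^ i).

Lemma size_powtrace_poly (f : {poly K}) D m : size f = D.+1 -> (0 < D)%N ->
  size (\sum_(i < m.+1) f ^+ (p ^ i)) = (D * p ^ m).+1.
Proof.
move=> sf D0.
have f0 : f != 0 by rewrite -size_poly_eq0 sf.
have sfX k : size (f ^+ k) = (D * k).+1 by rewrite size_exp_neq0 // sf.
elim: m => [|m IH]; first by rewrite big_ord1 sfX.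
rewrite big_ord_recr /= addrC size_polyDl sfX // IH ltnS ltn_pmul2l //.
by rewrite ltn_exp2l.
Qed.

Lemma expr_surj (Q : nat) (y : K) : (0 < Q)%N -> exists x : K, x ^+ Q = y.
Proof.
move=> Q0; have /closed_rootP[x] : size ('X^Q - y%:P) != 1%N.
  by rewrite size_XnsubC //; case: (Q) Q0.
by rewrite rootE !hornerE subr_eq0 => /eqP; exists x.
Qed.

(* With Q = p^{m+1} and T = sum_{i <= m} f^{p^i}, a point x counted here satisfies
   x^{Q^2} = x and T(x)^Q = a - T(x).  Hence G = sum c_{ii'j} X^{i + Q i'} T^j
   vanishes there as soon as sum c^Q_{ii'j} X^{Q i + i'} (a - T)^j = 0, a linear
   system with more unknowns than equations.  For i < Q/p and j < p the summands of
   G have distinct degrees because p does not divide D, so G <> 0. *)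
Lemma stepanov_bound (f : {poly K}) D m a (s : seq K) :
  size f = D.+1 -> (0 < D)%N -> coprime p D -> uniq s ->
  {in s, forall x, x ^+ (p ^ (m.+1 + m.+1)) = x /\ powtrace (m.+1 + m.+1) f.[x] = a} ->
  (size s <= p ^ (m.+1 + m) + (2 * D + 1) * p ^ m.+1)%N.
Proof.
move=> sf D0 cpD us sP.
pose I := (p ^ m)%N; pose Q := (p ^ m.+1)%N.
have QE : Q = (p * I)%N by rewrite /Q expnS.
have I0 : (0 < I)%N by rewrite expn_gt0 prime_gt0.
have Q0 : (0 < Q)%N by rewrite expn_gt0 prime_gt0.
pose T : {poly K} := \sum_(i < m.+1) f ^+ (p ^ i).
have sT : size T = (D * I).+1 by apply: size_powtrace_poly.
have T0 : T != 0 by rewrite -size_poly_eq0 sT.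
pose J : finType := ('I_I * 'I_(I + D) * 'I_p)%type.
pose dg (t : J) := (t.1.1 + I * (p * t.1.2 + D * t.2))%N.
pose P (t : J) : {poly K} := 'X^(t.1.1 + Q * t.1.2) * T ^+ t.2.
have sX (U : {poly K}) k n : size U = (D * I).+1 -> size ('X^k * U ^+ n) =
  (k + D * I * n).+1.
  move=> sU; have U0 : U != 0 by rewrite -size_poly_eq0 sU.
  rewrite size_monicM ?monicXn ?expf_neq0 // size_polyXn size_exp_neq0 // sU /=.
  by rewrite addnS.
have sPt t : size (P t) = (dg t).+1.
  by rewrite sX // /dg QE; congr _.+1; rewrite mulnDr addnA !mulnA (mulnC I p) (mulnC I D).
(* The degree modulo [I] gives [i]; after division by [I], the residue modulo [p] gives [j], because
   [p] does not divide [D]. *)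
have injdg : injective dg.
  move=> [[i i'] j] [[k k'] l]; rewrite /dg /= => h.
  have modI (x y : nat) : (x < I)%N -> ((x + I * y) %% I = x)%N.
    by move=> xI; rewrite addnC mulnC modnMDl modn_small.
  have eik : i = k :> nat by rewrite -[RHS](modI _ (p * k' + D * l)%N (ltn_ord k)) -h modI.
  move: h; rewrite eik => /addnI /eqP; rewrite eqn_pmul2l // => /eqP h.
  have le_eq (x y u v : nat) : (v < p)%N -> (u <= v)%N ->
      (p * x + D * u = p * y + D * v)%N -> u = v.
    move=> vp uv /(congr1 (fun n => n %% p)%N); rewrite !(mulnC p) !modnMDl => /esym/eqP.
    rewrite eqn_mod_dvd ?leq_mul2l ?uv ?orbT // -mulnBr Gauss_dvdr //.
    by case: (posnP (v - u)) => [|vu /(dvdn_leq vu)]; lia.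
  have ejl : j = l :> nat.
    by case/orP: (leq_total j l) => jl; [|symmetry]; apply: le_eq jl _; eauto.
  move: h; rewrite ejl => /addIn /eqP; rewrite eqn_pmul2l ?prime_gt0 // => /eqP ei.
  by congr (_, _, _); apply: val_inj.
pose W (t : J) : {poly K} := 'X^(Q * t.1.1 + t.1.2) * (a%:P - T) ^+ t.2.
have sW t : (size (W t) <= Q * I.-1 + (I + D).-1 + D * I * p.-1 + 1)%N.
  rewrite sX; last first.
    rewrite addrC size_polyDl size_polyN sT //.
    by rewrite (leq_ltn_trans (size_polyC_leq1 _)) // ltnS muln_gt0 D0.
  rewrite addn1 ltnS; apply: leq_add.
    apply: leq_add; first by rewrite leq_mul2l; apply/orP; right; have := ltn_ord t.1.1;
      lia.
    by have := ltn_ord t.1.2; lia.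
  by rewrite leq_mul2l; apply/orP; right; have := ltn_ord t.2; lia.
(* There are [Q * I + D * I * p] unknowns, which exceeds the size bound by [(Q - I) + (D * I - D)].
   The [D] extra values of [i'] pay for the degree of the powers of [T]. *)
have [|e e0 eW] := poly_lin_relation sW.
  rewrite !card_prod !card_ord.
  have -> : (I * (I + D) * p = Q * I + D * I * p)%N by rewrite QE; ring.
  have DI : (D <= D * I)%N by rewrite leq_pmulr.
  have QI : (I < Q)%N by rewrite ltn_exp2l.
  have -> : (Q * I = Q + Q * I.-1)%N by rewrite -mulnS prednK.
  have -> : (D * I * p = D * I + D * I * p.-1)%N by rewrite -mulnS prednK ?prime_gt0.
  by move: (Q * I.-1)%N (D * I * p.-1)%N (D * I)%N DI; lia.
(* The linear system is solved for the [Q]-th powers of the coefficients of [G]. *)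
have /fin_all_exists[c cP] (t : J) : exists x : K, x ^+ Q = e t by apply: expr_surj.
have c0 : exists t, c t != 0.
  case: e0 => t et; exists t; apply: contraNneq et => ct.
  by rewrite -cP ct expr0n (gtn_eqF Q0).
have P0 t : P t != 0 by rewrite -size_poly_eq0 sPt.
have Pinj : injective (fun t => size (P t)).
  by move=> t u; rewrite !sPt => -[]; apply: injdg.
have G0 := sum_poly_neq0 P0 Pinj c0.
set G := \sum_t _ in G0.
have rootsG : all (root G) s.
  apply/allP => x /sP[xq tra].
  (* The first half of the trace is [T.[x]], the second half its [Q]-th power. *)
  have TQ : T.[x] ^+ Q = a - T.[x].
    rewrite -tra /powtrace big_split_ord /=.
    have -> : T.[x] = \sum_(i < m.+1) f.[x] ^+ (p ^ i).
      by rewrite horner_sum; apply: eq_bigr => i _; rewrite horner_exp.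
    rewrite [RHS]addrC addKr sum_expr_pchar //; apply: eq_bigr => i _.
    by rewrite -exprM -expnD addnC.
  have xQQ : (x ^+ Q) ^+ Q = x by rewrite -exprM -expnD.
  have : G.[x] ^+ Q = 0.
    rewrite horner_sum sum_expr_pchar //.
    have := congr1 (fun g : {poly K} => g.[x]) eW; rewrite horner_sum horner0 => eWx.
    rewrite -[RHS]eWx.
    apply: eq_bigr => t _; rewrite !hornerE /= -cP !exprMn.
    congr (_ * _ * _); last by rewrite -!exprM mulnC exprM TQ.
    have E : ((t.1.1 + Q * t.1.2) * Q = Q * t.1.1 + Q * Q * t.1.2)%N by ring.
    by rewrite -exprM E !exprD [x ^+ (Q * Q * _)]exprM [x ^+ (Q * Q)]exprM xQQ.
  by move/eqP; rewrite expf_eq0 => /andP[_]; rewrite rootE.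
have := max_poly_roots G0 rootsG us.
have sG : (size G <= (I + Q * (I + D) + D * I * p).+1)%N.
  apply: (leq_trans (size_sum _ _ _)); apply/bigmax_leqP => t _.
  apply: (leq_trans (size_scale_leq _ _)); rewrite sX // ltnS.
  by do !apply: leq_add; rewrite ?leq_mul2l ?(ltnW (ltn_ord _)) ?orbT.
move=> /leq_trans /(_ sG); rewrite ltnS => /leq_trans; apply.
have -> : (p ^ (m.+1 + m) = Q * I)%N by rewrite expnD.
have QI : (I <= Q)%N by rewrite leq_exp2l.
rewrite -/Q; have -> : (D * I * p = D * Q)%N by rewrite QE; ring.
by move: QI; clearbody Q I; clear; nia.
Qed.

End Stepanov.

(** * Newton's identities *)

Section Newton.
Variable A : comNzRingType.
Implicit Types (rs : seq A) (c : {poly A}).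

Definition powersum rs (k : nat) : A := \sum_(x <- rs) x ^+ k.

(** The reversal of the product of the X - x; its coefficients are the signed elementary symmetric
    functions of [rs]. *)
Definition revprod rs : {poly A} := \prod_(x <- rs) (1 - x *: 'X).

Lemma coef_mul_1subX a c n :
  ((1 - a *: 'X) * c)`_n = c`_n - a * (if n == 0%N then 0 else c`_n.-1).
Proof. by rewrite mulrBl mul1r coefB -scalerAl coefZ coefXM. Qed.

Lemma size_revprod rs : (size (revprod rs) <= (size rs).+1)%N.
Proof.
rewrite /revprod; elim: rs => [|b s IHs] /=; first by rewrite big_nil size_poly1.
rewrite big_cons; apply: (leq_trans (size_polyMleq _ _)).
have : (size (1 - b *: 'X)%R <= 2)%N.
  rewrite (leq_trans (size_polyD _ _)) // size_polyN size_poly1 geq_max /=.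
  by rewrite (leq_trans (size_scale_leq _ _)) ?size_polyX.
move=> s1; rewrite -subn1 leq_subLR add1n; exact: leq_add s1 IHs.
Qed.

Lemma coef_revprod rs i : (i <= size rs)%N ->
  (revprod rs)`_i = (\prod_(x <- rs) ('X - x%:P))`_(size rs - i).
Proof.
rewrite /revprod; elim: rs i => [|a rs IH] i /=.
  by rewrite leqn0 => /eqP->; rewrite !big_nil.
rewrite !big_cons coef_mul_1subX mulrBl coefB coefXM coefCM => le_i.
set g := \prod_(_ <- _) ('X - _) in IH *.
have sg : size g = (size rs).+1 by rewrite size_prod_XsubC.
have [i0|i0] := posnP i.
  by rewrite i0 subn0 mulr0 subr0 IH // subn0 /= [g`_(size rs).+1]nth_default ?mulr0
    ?subr0 // sg.
have -> : g`_((size rs).+1 - i) = (\prod_(x <- rs) (1 - x *: 'X))`_i.-1.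
  by rewrite IH; [congr _`_ _|]; lia.
congr (_ - _); have [|lt_i] := leqP i (size rs).
  by move=> le; rewrite subn_eq0 leqNgt ltnS le /= IH // subSn.
have -> : i = (size rs).+1 by lia.
rewrite subnn eqxx nth_default //; exact: size_revprod.
Qed.

(** Newton's identities, the coefficients of X g' = - g sum_k p_k X^k. By induction on the list: a
    new root [a] multiplies g by 1 - a X, and the geometric series of [a] undoes this factor
    ([sum1]). *)
Lemma newton_revprod rs n :
  (revprod rs)`_n.+1 *+ n.+1 =
  \sum_(k < n.+1) - powersum rs k.+1 * (revprod rs)`_(n - k).
Proof.
rewrite /revprod; elim: rs n => [|a rs IH] n.
  rewrite big_nil coef1 mul0rn big1 // => k _.
  by rewrite /powersum big_nil oppr0 mul0r.
rewrite big_cons; set c := \prod_(x <- rs) _ in IH *.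
set c2 := (1 - a *: 'X) * c.
have c2E m : c2`_m = c`_m - a * (if m == 0%N then 0 else c`_m.-1) by exact: coef_mul_1subX.
have sum1 : \sum_(k < n.+1) a ^+ k.+1 * c2`_(n - k) = a * c`_n.
  elim: n => [|n IHn]; first by rewrite big_ord1 c2E mulr0 subr0.
  rewrite big_ord_recl subn0 c2E /=.
  under eq_bigr => k _ do rewrite /bump add1n exprS subSS -mulrA.
  by rewrite -mulr_sumr IHn; ring.
have sum2 : \sum_(k < n.+1) - powersum rs k.+1 * c2`_(n - k)
    = c`_n.+1 *+ n.+1 - a * c`_n *+ n.
  case: (n) => [|m].
    by rewrite big_ord1 c2E mulr0 subr0 mulr0n subr0 IH big_ord1.
  under eq_bigr => k _ do rewrite c2E mulrBr.
  rewrite sumrB -IH; congr (_ - _).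
  rewrite big_ord_recr /= subnn /= !mulr0 addr0.
  rewrite -mulrnAr IH mulr_sumr; apply: eq_bigr => k _.
  have lk := ltn_ord k; have -> : (m.+1 - k == 0)%N = false by lia.
  by rewrite mulrCA (_ : (m.+1 - k).-1 = m - k)%N //; lia.
rewrite (eq_bigr (fun k : 'I_n.+1 =>
  - powersum rs k.+1 * c2`_(n - k) - a ^+ k.+1 * c2`_(n - k))); last first.
  by move=> k _; rewrite /powersum big_cons; ring.
by rewrite sumrB sum2 sum1 c2E /= mulrSr; ring.
Qed.

(** As [c 0 = 1], the recursion is triangular and determines [S n.+1] from the earlier terms. *)
Lemma eq_newton (c S S' : nat -> A) N : c 0 = 1 ->
  (forall n, (n < N)%N -> \sum_(k < n.+1) S k.+1 * c (n - k)%N =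
                          \sum_(k < n.+1) S' k.+1 * c (n - k)%N) ->
  forall n, (n < N)%N -> S n.+1 = S' n.+1.
Proof.
move=> c0 H n; elim/ltn_ind: n => n IH nN.
have := H n nN; rewrite !big_ord_recr /= subnn c0 !mulr1.
rewrite (eq_bigr (fun k : 'I_n => S' k.+1 * c (n - k)%N)) => [/addrI //|k _].
by rewrite IH // (ltn_trans (ltn_ord k)).
Qed.

(** Only the D-th elementary symmetric function changes, so Newton's identities leave the lower
    power sums alone. *)
Lemma powersum_shift rs rs' D b : (0 < D <= size rs)%N ->
  \prod_(x <- rs') ('X - x%:P) =
    \prod_(x <- rs) ('X - x%:P) + b *: 'X^(size rs - D) ->
  (forall k, (k < D)%N -> powersum rs' k = powersum rs k) /\
  powersum rs' D = powersum rs D - b *+ D.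
Proof.
case: D => // D /= leD eqp.
have ss : size rs' = size rs.
  have := congr1 (fun g : {poly A} => size g) eqp.
  rewrite size_polyDl size_prod_XsubC.
    by rewrite size_prod_XsubC => -[].
  by rewrite (leq_ltn_trans (size_scale_leq _ _)) // size_polyXn; lia.
have ceq i : (i <= D.+1)%N -> (revprod rs')`_i = (revprod rs)`_i + (b *+ (i == D.+1)).
  move=> iD; rewrite !coef_revprod ?ss; try lia.
  rewrite eqp coefD coefZ coefXn; congr (_ + _).
  by rewrite (_ : (_ == _) = (i == D.+1)) ?mulr_natr //; lia.
have c0 r : (revprod r)`_0 = 1.
  have := lead_coef_prod_XsubC r xpredT id.
  by rewrite lead_coefE /= size_prod_XsubC coef_revprod // subn0.
have H n : (n < D)%N -> - powersum rs' n.+1 = - powersum rs n.+1.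
  apply: (@eq_newton (fun i => (revprod rs)`_i) (fun k => - powersum rs' k)
    (fun k => - powersum rs k)) => // m mD.
  rewrite -newton_revprod.
  have -> : (revprod rs)`_m.+1 = (revprod rs')`_m.+1.
    by rewrite ceq ?ltnS 1?ltnW // (_ : (_ == _) = false) ?mulr0n ?addr0 //; lia.
  rewrite newton_revprod; apply: eq_bigr => k _; rewrite ceq; last by lia.
  by rewrite (_ : (_ == _) = false) ?mulr0n ?addr0 //; lia.
split=> [[|k] kD|].
- by rewrite /powersum !big_const_seq !count_predT ss.
- by apply: oppr_inj; rewrite H.
have := newton_revprod rs' D; rewrite ceq // eqxx mulr1n mulrnDl newton_revprod.
rewrite !big_ord_recr /= subnn !c0 !mulr1.
rewrite [X in _ = X + _](eq_bigr
  (fun k : 'I_D => - powersum rs k.+1 * (revprod rs)`_(D - k))); last first.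
  move=> k _; rewrite H // ceq; last by lia.
  by rewrite (_ : (_ == _) = false) ?mulr0n ?addr0 //; lia.
by rewrite -addrA => /addrI h; rewrite -[LHS]opprK -h; ring.
Qed.
End Newton.

(** * Norms from finite fields and monic polynomials *)

Lemma sum_count_mem (T : eqType) (s : seq T) :
  (\sum_(x <- undup s) count_mem x s)%N = size s.
Proof.
rewrite -[RHS](perm_size (perm_count_undup s)) size_flatten /shape -map_comp sumnE big_map.
by apply: eq_bigr => x _ /=; rewrite size_nseq.
Qed.

Lemma dvdp_prod_XsubC_exp (F : fieldType) (s : seq F) j (g : {poly F}) : uniq s ->
  (\prod_(y <- s) ('X - y%:P) ^+ j %| g) = all (fun y => ('X - y%:P) ^+ j %| g) s.
Proof.
elim: s => [|y s IH] /=; first by rewrite big_nil dvd1p.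
case/andP=> ys us; rewrite big_cons Gauss_dvdp ?IH //.
rewrite prodrXl coprimep_sym; apply: coprimep_expl; apply: coprimep_expr.
by rewrite coprimep_XsubC root_prod_XsubC.
Qed.

Lemma sum_ord_eq m c : (\sum_(j < m) (j == c :> nat) = (c < m))%N.
Proof.
case: ltnP => h; last first.
  by apply: big1 => j _; rewrite ltn_eqF // (leq_trans (ltn_ord j)).
rewrite (bigD1 (Ordinal h)) //= eqxx big1 // => j.
by rewrite -val_eqE /= => /negPf->.
Qed.

Lemma eq_leq_right a b : (forall j, (j <= a)%N = (j <= b)%N) -> a = b.
Proof. by move=> H; apply: anti_leq; rewrite -H leqnn H leqnn. Qed.
Lemma mup_rmorph (F : fieldType) (s : {rmorphism F -> F}) (g : {poly F}) x :
  g != 0 -> map_poly s g = g -> mup (s x) g = mup x g.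
Proof.
move=> g0 sg; apply: eq_leq_right => j.
apply: (etrans (mup_geq _ _ g0)); apply: (etrans _ (esym (mup_geq _ _ g0))).
rewrite -[in LHS]sg.
have -> : ('X - (s x)%:P) ^+ j = map_poly s (('X - x%:P) ^+ j).
  by rewrite rmorphXn rmorphB /= map_polyX map_polyC.
exact: dvdp_map.
Qed.

Section PrimeField.
Variables (K : closedFieldType) (p : nat).
Hypothesis charKp : p \in [pchar K].

Let p_pr : prime p := pcharf_prime charKp.
Let p_gt0 : (0 < p)%N := prime_gt0 p_pr.
Let p_gt1 : (1 < p)%N := prime_gt1 p_pr.

Let pk_gt1 k : (0 < k)%N -> (1 < p ^ k)%N.
Proof. by move=> k0; rewrite -[X in (X < _)%N](expn0 p) ltn_exp2l. Qed.

Notation Fr := (pFrobenius_aut charKp).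

Definition roots_of (g : {poly K}) : seq K := sval (closed_field_poly_normal g).

Lemma roots_ofE g : g \is monic -> g = \prod_(x <- roots_of g) ('X - x%:P).
Proof.
rewrite /roots_of; case: closed_field_poly_normal => r /= E /monicP g1.
by rewrite {1}E g1 scale1r.
Qed.

Lemma size_roots_of g : g \is monic -> size (roots_of g) = (size g).-1.
Proof. by move=> /roots_ofE E; rewrite [in RHS]E size_prod_XsubC. Qed.

Lemma mem_roots_of g x : g \is monic -> (x \in roots_of g) = root g x.
Proof. by move=> /roots_ofE E; rewrite [in RHS]E root_prod_XsubC. Qed.

(** The field with [p ^ k] elements, as a list so that all these fields lie in one [K]. At [k = 0]
    the polynomial is zero, hence the condition [0 < k] below. *)
Definition Fq (k : nat) : seq K := roots_of ('X^(p ^ k) - 'X).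

Lemma size_Fq_poly k : (0 < k)%N -> size ('X^(p ^ k) - 'X : {poly K}) = (p ^ k).+1.
Proof.
move=> k0; rewrite size_polyDl size_polyXn // size_polyN size_polyX ltnS; exact: pk_gt1.
Qed.

Lemma monic_Fq_poly k : (0 < k)%N -> ('X^(p ^ k) - 'X : {poly K}) \is monic.
Proof.
move=> k0; apply/monicP; rewrite lead_coefE size_Fq_poly //= coefB coefXn eqxx coefX.
by rewrite gtn_eqF ?subr0 ?pk_gt1.
Qed.

Lemma mem_Fq k x : (0 < k)%N -> (x \in Fq k) = (x ^+ (p ^ k) == x).
Proof. by move=> k0; rewrite mem_roots_of ?monic_Fq_poly // rootE !hornerE subr_eq0. Qed.

Lemma size_Fq k : (0 < k)%N -> size (Fq k) = (p ^ k)%N.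
Proof. by move=> k0; rewrite size_roots_of ?monic_Fq_poly // size_Fq_poly. Qed.

(** The polynomial is separable: its derivative is -1. *)
Lemma uniq_Fq k : (0 < k)%N -> uniq (Fq k).
Proof.
move=> k0; rewrite -separable_prod_XsubC -roots_ofE ?monic_Fq_poly //.
rewrite separable_poly.unlock derivB derivXn derivX -mulr_natr.
have -> : (p ^ k)%:R = 0 :> {poly K}.
  by rewrite natrX -polyC_natr (pcharf0 charKp) polyC0 expr0n; case: (k) k0.
by rewrite mulr0 sub0r coprimep_sym -scaleN1r coprimepZl ?oppr_eq0 ?oner_neq0 ?coprime1p.
Qed.

Lemma Frob_inj : injective (fun x : K => x ^+ p).
Proof. exact: (fmorph_inj Fr). Qed.

Lemma exp_pk_inj k : injective (fun x : K => x ^+ (p ^ k)).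
Proof.
elim: k => [|k IH] x y; first by rewrite !expr1.
by rewrite !expnSr !exprM => /Frob_inj /IH.
Qed.

Lemma uniq_natr : uniq [seq n%:R : K | n <- iota 0 p].
Proof.
  rewrite map_inj_in_uniq ?iota_uniq // => m n; rewrite !mem_iota /= => mp np.
  wlog mn : m n mp np / (m <= n)%N.
    by case: (leqP m n) => [|/ltnW] h W; [|symmetry]; apply: W => //; rewrite W.
  move/esym/eqP; rewrite -subr_eq0 -natrB // -(dvdn_pcharf charKp) => d.
  by case: (posnP (n - m)) d => [|h /(dvdn_leq h)]; lia.
Qed.

Lemma perm_Fp : perm_eq (Fq 1) [seq n%:R | n <- iota 0 p].
Proof.
have u := uniq_natr.
have sub : {subset [seq n%:R | n <- iota 0 p] <= Fq 1}.
  move=> x /mapP[n _ ->]; rewrite mem_Fq // expn1.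
  by rewrite -[_ ^+ p]/(Fr _) pFrobenius_aut_nat.
have [|_ e] := uniq_min_size u sub; first by rewrite size_Fq // size_map size_iota expn1.
by apply: uniq_perm; [apply: uniq_Fq | | move=> x; rewrite e].
Qed.

Lemma FpP (y : K) : y ^+ p = y -> exists2 n, (n < p)%N & y = n%:R.
Proof.
move=> yp; have : y \in Fq 1 by rewrite mem_Fq // expn1 yp.
by rewrite (perm_mem perm_Fp) => /mapP[n]; rewrite mem_iota => np ->; exists n.
Qed.

(** Membership in F_p[X], expressed inside [{poly K}]. *)
Definition fixedp (g : {poly K}) := map_poly Fr g == g.

Lemma fixed_coef g i : fixedp g -> g`_i ^+ p = g`_i.
Proof. by move=> /eqP fg; rewrite -[in RHS]fg coef_map. Qed.

Fixpoint monics (n : nat) : seq {poly K} :=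
  if n is n'.+1 then [seq g * 'X + c%:P | g <- monics n', c <- Fq 1] else [:: 1].

Lemma monicsP n g :
  reflect [/\ g \is monic, size g = n.+1 & fixedp g] (g \in monics n).
Proof.
elim: n g => [|n IH] g /=.
  rewrite inE; apply: (iffP eqP) => [->|[/monicP gm sg _]].
    by rewrite monic1 size_poly1 /fixedp rmorph1.
  have /size_poly1P[c _ gc] : size g == 1%N by rewrite sg.
  by move: gm; rewrite gc lead_coefC => ->.
apply: (iffP allpairsP) => [[[h c] /= [/IH[hm sh hf] cF ->]]|[gm sg gf]].
  have h0 : h != 0 by rewrite -size_poly_eq0 sh.
  have sE : size (h * 'X + c%:P) = n.+2.
    by rewrite size_MXaddC (negPf h0) sh.
  split=> //; first by rewrite monicE lead_coefE sE /= coefD coefMX coefC /= addr0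
    -[n]/(n.+1.-1) -sh -lead_coefE.
  rewrite /fixedp rmorphD rmorphM /= map_polyX map_polyC /= (eqP hf).
  by move: cF; rewrite mem_Fq // expn1 pFrobenius_autE => /eqP->.
exists (\poly_(i < n.+1) g`_i.+1, g`_0) => /=.
have gE : g = (\poly_(i < n.+1) g`_i.+1) * 'X + (g`_0)%:P.
  apply/polyP => i; rewrite coefD coefMX coefC coef_poly.
  case: i => [|i] /=; first by rewrite add0r.
  by rewrite addr0; case: ltnP => // h; rewrite nth_default // sg.
have lc : g`_n.+1 = 1 by rewrite -[n.+1]/(n.+2.-1) -sg -lead_coefE (monicP gm).
split=> //; last by rewrite mem_Fq // expn1 fixed_coef.
have s : size (\poly_(i < n.+1) g`_i.+1) = n.+1 by rewrite size_poly_eq // lc oner_neq0.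
apply/IH; split=> //; first by rewrite monicE lead_coefE s coef_poly ltnSn lc.
apply/eqP/polyP => i; rewrite coef_map !coef_poly; case: ifP => _; last exact: rmorph0.
exact: fixed_coef.
Qed.

Lemma uniq_monics n : uniq (monics n).
Proof.
elim: n => //= n IH; apply: allpairs_uniq => //; first exact: uniq_Fq.
move=> [g c] [h d] _ _ /= E.
have ec : c = d by have := congr1 (fun u : {poly K} => u`_0) E;
  rewrite !coefD !coefMX !coefC !add0r.
congr (_, _) => //; move: E; rewrite ec => /addIr /(mulIf _) -> //.
by rewrite polyX_eq0.
Qed.

(* For x in F_{p^k}: the norm of X - x from F_{p^k}[X] to F_p[X]. *)
Definition Nrm (k : nat) (x : K) : {poly K} := \prod_(i < k) ('X - (x ^+ (p ^ i))%:P).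

Lemma size_Nrm k x : size (Nrm k x) = k.+1.
Proof. by rewrite size_prod_XsubC /index_enum -enumT size_enum_ord. Qed.

Lemma monic_Nrm k x : Nrm k x \is monic.
Proof. exact: monic_prod_XsubC. Qed.

(** Frobenius permutes the linear factors cyclically. *)
Lemma fixed_Nrm k x : x \in Fq k.+1 -> fixedp (Nrm k.+1 x).
Proof.
rewrite mem_Fq // => /eqP xk;
  rewrite /fixedp /Nrm rmorph_prod /= big_ord_recr big_ord_recl /=.
rewrite mulrC !rmorphB /= !map_polyX !map_polyC /= !pFrobenius_autE -!exprM -expnSr xk
  expr1.
apply/eqP; congr (_ * _); apply: eq_bigr => i _.
by rewrite rmorphB /= map_polyX map_polyC /= pFrobenius_autE -exprM -expnSr /bump add1n.
Qed.

Lemma Nrm_monics k x : x \in Fq k.+1 -> Nrm k.+1 x \in monics k.+1.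
Proof. by move=> xk; apply/monicsP; split;
  [exact: monic_Nrm|exact: size_Nrm|exact: fixed_Nrm]. Qed.

Lemma exp_pk_mul (x : K) e j : x ^+ (p ^ e) = x -> x ^+ (p ^ (e * j)) = x.
Proof.
move=> xe; elim: j => [|j IH]; first by rewrite muln0 expr1.
by rewrite mulnS expnD exprM xe.
Qed.

Lemma Nrm_exp (x : K) e j : x ^+ (p ^ e) = x -> Nrm (e * j) x = Nrm e x ^+ j.
Proof.
move=> xe; elim: j => [|j IH]; first by rewrite muln0 expr0 /Nrm big_ord0.
rewrite exprS -IH mulnS /Nrm big_split_ord /=; congr (_ * _).
by apply: eq_bigr => i _; rewrite expnD exprM xe.
Qed.

Lemma mup_conj g (x : K) k : g != 0 -> fixedp g -> mup (x ^+ (p ^ k)) g = mup x g.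
Proof.
move=> g0 gf; elim: k => [|k IH]; first by rewrite expr1.
rewrite -IH expnSr exprM; exact: (@mup_rmorph _ Fr _ _ g0 (eqP gf)).
Qed.

Lemma exp_pk_sub (x : K) i j : (i <= j)%N -> x ^+ (p ^ i) = x ^+ (p ^ j) ->
  x ^+ (p ^ (j - i)) = x.
Proof.
move=> ij E; apply: (@exp_pk_inj i).
by rewrite -exprM -expnD subnK.
Qed.

(** The first [size g] conjugates of [x] are roots of [g], which has fewer roots than that; so two
    of them coincide, and Frobenius is injective. *)
Lemma root_period g (x : K) : g != 0 -> fixedp g -> root g x ->
  exists e, (0 < e)%N && (x ^+ (p ^ e) == x).
Proof.
move=> g0 gf gx; pose s := [seq x ^+ (p ^ i) | i <- iota 0 (size g)].
have rs : all (root g) s.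
  apply/allP => _ /mapP[i _ ->].
  by rewrite -dvdp_XsubCl XsubC_dvd // mup_conj // -XsubC_dvd // dvdp_XsubCl.
case: (boolP [exists e : 'I_(size g), (0 < e)%N && (x ^+ (p ^ e) == x)]).
  by case/existsP => e; exists e.
move/existsPn => H; suff us : uniq s.
  by have := max_poly_roots g0 rs us; rewrite size_map size_iota ltnn.
rewrite map_inj_in_uniq ?iota_uniq // => i j; rewrite !mem_iota !add0n /= => ig jg E.
apply/eqP; rewrite eqn_leq; apply/andP; split; rewrite leqNgt; apply/negP => lt.
  have lt' : (i - j < size g)%N by apply: leq_ltn_trans (leq_subr _ _) _.
  have /= := H (Ordinal lt'); rewrite subn_gt0 lt /= exp_pk_sub ?eqxx //; exact: ltnW.
have lt' : (j - i < size g)%N by apply: leq_ltn_trans (leq_subr _ _) _.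
have /= := H (Ordinal lt'); rewrite subn_gt0 lt /= exp_pk_sub ?eqxx //; exact: ltnW.
Qed.

(** Let [e] be the least period of [x]. The nonzero terms are those with [k.+1 = e * j] and
    [j <= mup x g]: there the norm is the j-th power of the minimal polynomial of [x]. *)
Lemma count_Nrm_at g n x : g \in monics n -> root g x ->
  (\sum_(k < n) ((x ^+ (p ^ k.+1) == x)%R && (Nrm k.+1 x %| g)%R) = mup x g)%N.
Proof.
move=> /monicsP[gm sg gf] gx; have g0 := monic_neq0 gm.
case: (ex_minnP (root_period g0 gf gx)) => e /andP[e0 /eqP xe] emin.
have per k : (x ^+ (p ^ k) == x) = (e %| k)%N.
  apply/eqP/idP => [|/dvdnP[j ->]]; last by rewrite mulnC exp_pk_mul.
  rewrite {1}(divn_eq k e) expnD exprM [(_ * e)%N]mulnC exp_pk_mul // => xr.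
  rewrite /dvdn; case: (posnP (k %% e)) => [//|r0].
  by have := emin (k %% e)%N; rewrite r0 xr eqxx leqNgt ltn_pmod // => /(_ isT).
(* The [e] conjugates of [x] are distinct and have the same multiplicity in [g]. *)
have Ndvd j : (Nrm (e * j) x %| g) = (j <= mup x g)%N.
  rewrite Nrm_exp // /Nrm -prodrXl
    -(big_map (fun i : 'I_e => x ^+ (p ^ i)) xpredT (fun y => ('X - y%:P) ^+ j)).
  rewrite dvdp_prod_XsubC_exp; last first.
    rewrite map_inj_uniq ?index_enum_uniq // => i k E; apply: val_inj => /=.
    apply/eqP; rewrite eqn_leq; apply/andP; split; rewrite leqNgt; apply/negP => lt.
      have := emin (i - k)%N; rewrite subn_gt0 lt exp_pk_sub ?eqxx //; last exact: ltnW.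
      by move/(_ isT); have := ltn_ord i; lia.
    have := emin (k - i)%N; rewrite subn_gt0 lt exp_pk_sub ?eqxx //; last exact: ltnW.
    by move/(_ isT); have := ltn_ord k; lia.
  apply/allP/idP => [H|H _ /mapP[i _ ->]];
    last by rewrite -(mup_geq _ _ g0) (mup_conj _ _ g0 gf).
  rewrite (mup_geq _ _ g0); apply: H; apply/mapP; exists (Ordinal e0) => //.
  by rewrite mem_index_enum.
have em : (e * mup x g <= n)%N.
  have : Nrm (e * mup x g) x %| g by rewrite Ndvd.
  by move/(dvdp_leq g0); rewrite size_Nrm sg.
transitivity (\sum_(k < n) \sum_(j < mup x g) (k.+1 == e * j.+1))%N.
  apply: eq_bigr => k _; rewrite per; case: (boolP (e %| _)%N) => [|ndvd] /=; last first.
    rewrite big1 // => j _; case: eqP => // E; move: ndvd; by rewrite E dvdn_mulr.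
  case/dvdnP => -[|j]; first by rewrite mul0n.
  rewrite mulnC => E; rewrite E Ndvd -(sum_ord_eq _ j).
  by apply: eq_bigr => i _; rewrite eqn_pmul2l // eqSS eq_sym.
rewrite exchange_big /= (eq_bigr (fun=> 1%N)) ?sum1_card ?card_ord // => j _.
have lt : ((e * j.+1).-1 < n)%N.
  have : (e * j.+1 <= e * mup x g)%N by rewrite leq_mul2l ltn_ord orbT.
  by have : (0 < e * j.+1)%N by [rewrite muln_gt0 e0]; lia.
transitivity (\sum_(k < n) (k == (e * j.+1).-1 :> nat))%N; last by rewrite sum_ord_eq lt.
apply: eq_bigr => k _; congr (nat_of_bool _).
by have : (0 < e * j.+1)%N by [rewrite muln_gt0 e0]; lia.
Qed.

(** Only roots of [g] contribute, each its multiplicity. This replaces the logarithmic derivative of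
    an Euler product, without irreducible polynomials. *)
Lemma count_Nrm g n : g \in monics n ->
  (\sum_(k < n) \sum_(x <- Fq k.+1) (Nrm k.+1 x %| g)%R = n)%N.
Proof.
move=> gn; have /monicsP[gm sg gf] := gn; have g0 := monic_neq0 gm.
transitivity (\sum_(k < n) \sum_(x <- undup (roots_of g))
    ((x ^+ (p ^ k.+1) == x)%R && (Nrm k.+1 x %| g)%R))%N.
  apply: eq_bigr => k _.
  have E (P : pred K) (r : seq K) : (\sum_(x <- r) P x = size [seq x <- r | P x])%N.
    by rewrite size_filter -sum1_count [RHS]big_mkcond; apply: eq_bigr => x _; case: (P x).
  rewrite (E (fun x => Nrm k.+1 x %| g))
    (E (fun x => (x ^+ (p ^ k.+1) == x) && (Nrm k.+1 x %| g))).
  apply: perm_size; apply: uniq_perm.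
  - by rewrite filter_uniq // uniq_Fq.
  - by rewrite filter_uniq // undup_uniq.
  move=> x; rewrite !mem_filter mem_undup mem_Fq // mem_roots_of // -dvdp_XsubCl andbC.
  case: eqP => //= _; case: (boolP (Nrm _ _ %| g)) => // H; rewrite (dvdp_trans _ H) //.
  by rewrite /Nrm big_ord_recl expr1 dvdp_mulr.
rewrite exchange_big /= (eq_big_seq (fun x => count_mem x (roots_of g))).
  by rewrite sum_count_mem size_roots_of // sg.
move=> x; rewrite mem_undup mem_roots_of // => gx.
by rewrite (count_Nrm_at gn gx) {1}(roots_ofE gm) mu_prod_XsubC.
Qed.

End PrimeField.

(** * The L-function of an additive character *)

Section LFunction.
Local Arguments monics : simpl never.
Variables (K : closedFieldType) (p : nat).
Hypothesis charKp : p \in [pchar K].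
Variables (C : closedFieldType) (zeta : C).
Hypothesis zetaP : p.-primitive_root zeta.

Let p_pr : prime p := pcharf_prime charKp.
Let p_gt0 : (0 < p)%N := prime_gt0 p_pr.

Notation Fr := (pFrobenius_aut charKp).

(** The character n -> zeta^n of F_p. Outside F_p the index is [p] and the value is 1. *)
Definition addchar (y : K) : C := zeta ^+ index y [seq n%:R | n <- iota 0 p].

Lemma addchar_nat n : addchar n%:R = zeta ^+ n.
Proof.
rewrite -(GRing.natr_mod_pchar charKp n) -(prim_expr_mod zetaP); congr (_ ^+ _).
have np : (n %% p < size [seq i%:R : K | i <- iota 0 p])%N by rewrite size_map size_iota
  ltn_pmod.
rewrite -[RHS](index_uniq 0 np (uniq_natr charKp)) (nth_map 0%N) ?nth_iota ?size_iota
  ?ltn_pmod //.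
Qed.

Lemma addcharD y z : y ^+ p = y -> z ^+ p = z ->
  addchar (y + z) = addchar y * addchar z.
Proof.
move=> /(FpP charKp)[m _ ->] /(FpP charKp)[n _ ->].
by rewrite -natrD !addchar_nat exprD.
Qed.

Lemma addchar_eq1 y : y ^+ p = y -> (addchar y == 1) = (y == 0).
Proof.
move=> /(FpP charKp)[m _ ->]; rewrite addchar_nat -(prim_order_dvd zetaP).
by rewrite (dvdn_pcharf charKp).
Qed.

Variables (f : {poly K}) (D : nat).
Hypotheses (fixf : fixedp charKp f) (sf : size f = D.+1) (D_gt0 : (0 < D)%N).
Hypothesis coDp : coprime p D.

Definition fsum (rs : seq K) : K := \sum_(x <- rs) f.[x].
Definition chi (g : {poly K}) : C := addchar (fsum (roots_of g)).

Lemma horner_Frob x : f.[x] ^+ p = f.[x ^+ p].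
Proof.
rewrite -!(pFrobenius_autE charKp) -[in RHS](eqP fixf).
by rewrite -horner_map.
Qed.

Lemma horner_Frob_iter x k : f.[x] ^+ (p ^ k) = f.[x ^+ (p ^ k)].
Proof. by elim: k => [|k IH]; rewrite ?expr1 // expnSr !exprM IH horner_Frob. Qed.

Lemma roots_of_prod rs : perm_eq (roots_of (\prod_(x <- rs) ('X - x%:P) : {poly K})) rs.
Proof. by apply: prod_XsubC_eq; rewrite -roots_ofE // (monic_prod_XsubC rs xpredT id). Qed.

Lemma fsum_perm rs rs' : perm_eq rs rs' -> fsum rs = fsum rs'.
Proof. exact: perm_big. Qed.

(** Frobenius permutes the roots of a polynomial over F_p, so the sum lies in F_p, where [addchar]
    is additive. *)
Lemma fsum_fixed n g : g \in monics K p n -> fsum (roots_of g) ^+ p = fsum (roots_of g).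
Proof.
case/monicsP => gm _ gf.
rewrite -[in LHS](expn1 p) /fsum sum_expr_pchar //.
under eq_bigr => x _ do rewrite expn1 horner_Frob -(pFrobenius_autE charKp).
rewrite -(big_map Fr xpredT (fun x => f.[x])); apply: fsum_perm.
apply: prod_XsubC_eq;
  rewrite -roots_ofE // -[RHS](eqP gf) [in RHS](roots_ofE gm) rmorph_prod big_map.
by apply: eq_bigr => x _; rewrite rmorphB /= map_polyX map_polyC.
Qed.

Lemma chiM m n g h : g \in monics K p m -> h \in monics K p n ->
  chi (g * h) = chi g * chi h.
Proof.
move=> gm hn; rewrite /chi -(addcharD (fsum_fixed gm) (fsum_fixed hn)); congr addchar.
rewrite -big_cat; apply: fsum_perm; rewrite -(permPr (roots_of_prod _)) big_cat /=.
by case/monicsP: gm => gm _ _; case/monicsP: hn => hm _ _; rewrite -!roots_ofE.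
Qed.

Lemma fsum_Nrm k x : fsum (roots_of (Nrm p k x)) = powtrace p k f.[x].
Proof.
rewrite /Nrm -(big_map (fun i : 'I_k => x ^+ (p ^ i)) xpredT (fun y => 'X - y%:P)).
rewrite (fsum_perm (roots_of_prod _)) /fsum big_map.
by apply: eq_bigr => i _; rewrite horner_Frob_iter.
Qed.

Definition expsum (k : nat) : C := \sum_(x <- Fq K p k) addchar (powtrace p k f.[x]).
(** Coefficients of the L-function sum_g chi(g) T^(deg g). *)
Definition Lcoef (n : nat) : C := \sum_(g <- monics K p n) chi g.

Lemma Lcoef0 : Lcoef 0 = 1.
Proof.
rewrite /Lcoef big_seq1 /chi.
have /size0nil-> : size (roots_of (1 : {poly K})) = 0%N by rewrite size_roots_of ?monic1
  ?size_poly1.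
by rewrite /fsum big_nil; apply: (addchar_nat 0).
Qed.

(** By [count_Nrm], [n.+1] counts the norms dividing [g]. Exchange the sums and factor [g] as a norm
    times [h]: [chi] is multiplicative, and [h] runs over [monics K p (n - k)]. *)
Lemma Lcoef_newton n :
  Lcoef n.+1 *+ n.+1 = \sum_(k < n.+1) expsum k.+1 * Lcoef (n - k).
Proof.
have -> : Lcoef n.+1 *+ n.+1 = \sum_(g <- monics K p n.+1)
    \sum_(k < n.+1) \sum_(x <- Fq K p k.+1) (if Nrm p k.+1 x %| g then chi g else 0).
  rewrite -sumrMnl; apply: eq_big_seq => g gn;
    rewrite -[in LHS](count_Nrm charKp gn) -sumrMnr.
  apply: eq_bigr => k _; rewrite -sumrMnr; apply: eq_bigr => x _.
  by case: ifP; rewrite ?mulr1n ?mulr0n.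
rewrite exchange_big; apply: eq_bigr => k _; rewrite exchange_big mulr_suml /=.
apply: eq_big_seq => x xk; rewrite -fsum_Nrm -/(chi _).
rewrite -big_mkcond -big_filter mulr_sumr.
have kn : (k <= n)%N by rewrite -ltnS.
have Nk := Nrm_monics charKp xk.
have /monicsP[Nm sN fN] := Nk.
rewrite (perm_big (map (fun h => Nrm p k.+1 x * h) (monics K p (n - k)))); last first.
  apply: uniq_perm; first exact: filter_uniq (uniq_monics charKp _).
    by rewrite map_inj_uniq ?uniq_monics //; apply: mulfI; apply: monic_neq0.
  move=> g; rewrite mem_filter; apply/andP/mapP => [[/dvdpP[h E]]|[h hn ->]].
    case/monicsP => gm sg gf; exists h; last by rewrite E mulrC.
    have hm : h \is monic by move: gm; rewrite E monicMr.
    apply/monicsP; split=> //.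
      have := size_Mmonic (monic_neq0 hm) Nm; rewrite -E sg sN addnS /= => eh.
      by apply/eqP; rewrite -(eqn_add2r k.+1) -eh addSn addnS subnK.
    apply/eqP; apply: (mulIf (monic_neq0 Nm)); rewrite -E -[RHS](eqP gf) E rmorphM /=.
    by rewrite (eqP fN).
  rewrite dvdp_mulr //; split=> //.
  case/monicsP: hn => hm sh fh; apply/monicsP; split; first by rewrite monicMl.
    rewrite (size_monicM Nm (monic_neq0 hm)) sN sh.
    by rewrite addSn /= addSn addnS subnKC.
  by rewrite /fixedp rmorphM /= (eqP fN) (eqP fh).
by rewrite big_map; apply: eq_big_seq => h hn; rewrite (chiM Nk hn).
Qed.

Lemma fsum_powersum rs : fsum rs = \sum_(k < D.+1) f`_k * powersum rs k.
Proof.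
rewrite /fsum (eq_bigr (fun x => \sum_(k < D.+1) f`_k * x ^+ k)); last first.
  by move=> x _; rewrite (horner_coef_wide _ (eq_leq sf)).
by rewrite exchange_big; apply: eq_bigr => k _; rewrite mulr_sumr.
Qed.

(** Adding ['X^(n - D)] permutes the monic polynomials of degree [n] and lowers the D-th power sum
    of the roots by [D]. Every [chi g] gets multiplied by the same constant, different from 1. *)
Lemma Lcoef_eq0 n : (D <= n)%N -> Lcoef n = 0.
Proof.
move=> Dn; pose sh (g : {poly K}) := g + 'X^(n - D).
have sX : (size ('X^(n - D) : {poly K}) <= n)%N by rewrite size_polyXn; lia.
have fXn : map_poly Fr 'X^(n - D) = 'X^(n - D) by rewrite map_polyXn.
have shP g : g \in monics K p n -> sh g \in monics K p n.
  case/monicsP => /monicP gm sg gf; have ss : size (sh g) = n.+1.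
    by rewrite size_polyDl sg // ltnS.
  apply/monicsP; split=> //; first by rewrite monicE lead_coefDl ?gm // sg ltnS.
  by rewrite /fixedp rmorphD /= (eqP gf) fXn.
have perm_sh : perm_eq (map sh (monics K p n)) (monics K p n).
  have u : uniq (map sh (monics K p n)).
    by rewrite map_inj_uniq ?uniq_monics //; apply: addIr.
  have sub : {subset map sh (monics K p n) <= monics K p n}.
    by move=> _ /mapP[g gn ->]; apply: shP.
  apply: uniq_perm => //; first exact: uniq_monics.
  by have [|_] := uniq_min_size u sub; first by rewrite size_map.
(* The resulting change of [fsum]; it is nonzero because [p] does not divide [D]. *)
set t : K := - (f`_D *+ D).
have fD0 : f`_D != 0 by rewrite -[D]/(D.+1.-1) -sf -lead_coefE lead_coef_eq0
  -size_poly_eq0 sf.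
have t0 : t != 0.
  rewrite oppr_eq0 -mulr_natr mulf_neq0 // -(dvdn_pcharf charKp).
  by rewrite -prime_coprime.
have tp : t ^+ p = t.
  rewrite -(pFrobenius_autE charKp) /t rmorphN rmorphMn /=.
  by rewrite pFrobenius_autE (fixed_coef _ fixf).
have chi_sh g : g \in monics K p n -> chi (sh g) = chi g * addchar t.
  move=> gn; rewrite /chi -(addcharD (fsum_fixed gn) tp); congr addchar.
  have /monicsP[gm sg _] := gn; have /monicsP[shm _ _] := shP _ gn.
  have sr : size (roots_of g) = n by rewrite size_roots_of // sg.
  have D_le : (0 < D <= size (roots_of g))%N by rewrite sr D_gt0.
  have shE : \prod_(x <- roots_of (sh g)) ('X - x%:P) =
      \prod_(x <- roots_of g) ('X - x%:P) + 1 *: 'X^(size (roots_of g) - D).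
    by rewrite -!roots_ofE // sr scale1r.
  have [eqk eqD] := powersum_shift D_le shE.
  rewrite !fsum_powersum !big_ord_recr /= eqD mulrBr addrA; congr (_ + _).
    by congr (_ + _); apply: eq_bigr => k _; rewrite eqk.
  by rewrite mulrnAr mulr1.
have : Lcoef n = Lcoef n * addchar t.
  rewrite {1}/Lcoef -(perm_big _ perm_sh) big_map mulr_suml.
  by apply: eq_big_seq => g; apply: chi_sh.
move/eqP; rewrite -{1}[Lcoef n]mulr1 -subr_eq0 -mulrBr mulf_eq0 => /orP[/eqP//|].
by rewrite subr_eq0 eq_sym addchar_eq1 // (negPf t0).
Qed.

(** The numbers are the roots of the reversed L-function; [Lcoef_newton] and Newton's identities
    give both sequences the same triangular recursion. *)
Lemma expsum_roots : exists2 rs : seq C, size rs = D.-1 &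
  forall k, expsum k.+1 = - powersum rs k.+1.
Proof.
pose L := \poly_(i < D) Lcoef (D.-1 - i).
have sL : size L = D.
  by rewrite size_poly_eq // subnn Lcoef0 oner_neq0.
have Lm : L \is monic.
  by rewrite monicE lead_coefE sL coef_poly prednK // leqnn subnn Lcoef0.
have srs : size (roots_of L) = D.-1 by rewrite size_roots_of // sL.
exists (roots_of L) => // k.
have LE i : Lcoef i = (revprod (roots_of L))`_i.
  have [iD|Di] := leqP i D.-1.
    rewrite coef_revprod ?srs // -roots_ofE // coef_poly ifT; last by lia.
    by rewrite subKn.
  rewrite Lcoef_eq0; last by lia.
  by rewrite nth_default // (leq_trans (size_revprod _)) // srs.
have := @eq_newton _ Lcoef expsum (fun k => - powersum (roots_of L) k) k.+1 Lcoef0.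
apply=> // n _; rewrite -Lcoef_newton LE newton_revprod.
by apply: eq_bigr => j _; rewrite LE.
Qed.

End LFunction.

(** * Weil's inequality *)

Lemma norm_prim_root (A : numDomainType) (n k : nat) (z : A) :
  n.-primitive_root z -> `|z ^+ k| = 1.
Proof.
move=> zP; apply/eqP; rewrite -(@pexpr_eq1 _ _ n) ?(prim_order_gt0 zP) //.
by rewrite -normrX -exprM mulnC exprM (prim_expr_order zP) expr1n normr1.
Qed.

Section ExpsumBound.
Variables (K : closedFieldType) (p : nat).
Hypothesis charKp : p \in [pchar K].
Variables (C : numClosedFieldType) (zeta : C).
Hypothesis zetaP : p.-primitive_root zeta.
Variables (f : {poly K}) (D : nat).
Hypotheses (fixf : fixedp charKp f) (sf : size f = D.+1) (D_gt0 : (0 < D)%N).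
Hypothesis coDp : coprime p D.

Let p_pr : prime p := pcharf_prime charKp.

Lemma sum_zeta : \sum_(n < p) zeta ^+ n = 0.
Proof.
have p1 := prime_gt1 p_pr; have := subrX1 zeta p.
rewrite (prim_expr_order zetaP) subrr => /esym/eqP;
  rewrite mulf_eq0 subr_eq0 => /orP[/eqP z1|/eqP//].
by have := prim_order_dvd zetaP 1; rewrite z1 expr1 eqxx dvdn1 gtn_eqF.
Qed.

(** By Stepanov's bound the trace takes each value at most [A] times. As the [zeta ^+ n] sum to 0,
    these multiplicities can be replaced by their deficits from [A], whose total is
    [p * A - p ^ k]. *)
Lemma expsum_le m :
  `|expsum p zeta f (m.+1 + m.+1)| <= (p * ((2 * D + 1) * p ^ m.+1))%:R.
Proof.
pose k := (m.+1 + m.+1)%N; pose s n := [seq x <- Fq K p k | powtrace p k f.[x] == n%:R].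
pose A := (p ^ (m.+1 + m) + (2 * D + 1) * p ^ m.+1)%N.
have sA n : (size (s n) <= A)%N.
  apply: (@stepanov_bound K p charKp f D m n%:R) => //;
    first by rewrite filter_uniq // uniq_Fq.
  move=> x; rewrite mem_filter mem_Fq // => /andP[/eqP tx /eqP xk].
  by split.
have trE x : x \in Fq K p k -> exists2 n : 'I_p, powtrace p k f.[x] = n%:R &
    addchar p zeta (powtrace p k f.[x]) = zeta ^+ n.
  move=> xk; have := fsum_fixed fixf (Nrm_monics charKp xk); rewrite (fsum_Nrm fixf).
  case/(FpP charKp) => n np ->; exists (Ordinal np) => //.
  by rewrite (addchar_nat charKp zetaP).
have natI (i j : 'I_p) : i%:R = j%:R :> K -> i = j.
  move/(congr1 (addchar p zeta)); rewrite !(addchar_nat charKp zetaP) => /eqP.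
  by rewrite (eq_prim_root_expr zetaP) !modn_small // => /eqP /val_inj.
have split1 x : x \in Fq K p k -> addchar p zeta (powtrace p k f.[x]) =
    \sum_(n < p) (powtrace p k f.[x] == n%:R)%:R * zeta ^+ n.
  case/trE => n En ->; rewrite (bigD1 n) //= En eqxx mul1r big1 ?addr0 // => j jn.
  by case: eqP => [/natI nj|_]; rewrite ?mul0r //; rewrite nj eqxx in jn.
have ss n : (size (s n) = \sum_(x <- Fq K p k) (powtrace p k f.[x] == n%:R)%R)%N.
  by rewrite size_filter -sum1_count big_mkcond; apply: eq_bigr => x _; case: eqP.
have ES : expsum p zeta f k = \sum_(n < p) (size (s n))%:R * zeta ^+ n.
  rewrite /expsum (eq_big_seq _ split1) exchange_big; apply: eq_bigr => n _.
  by rewrite -mulr_suml -natr_sum ss.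
have tot : (\sum_(n < p) size (s n) = p ^ k)%N.
  rewrite -(size_Fq charKp (isT : (0 < k)%N)) -[RHS]sum1_size.
  rewrite (eq_bigr _ (fun (n : 'I_p) _ => ss n)).
  rewrite exchange_big; apply: eq_big_seq => x /trE[n En _].
  rewrite (bigD1 n) //= En eqxx big1 // => j jn.
  by case: eqP => // /natI nj; rewrite nj eqxx in jn.
have -> : expsum p zeta f k = - \sum_(n < p) (A - size (s n))%:R * zeta ^+ n.
  rewrite ES; apply/eqP; rewrite -addr_eq0 -big_split /=.
  rewrite (eq_bigr (fun n : 'I_p => A%:R * zeta ^+ n)) -?mulr_sumr ?sum_zeta ?mulr0 //
    => n _.
  by rewrite -mulrDl -natrD subnKC.
rewrite normrN; apply: (le_trans (ler_norm_sum _ _ _)).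
under eq_bigr => n _ do rewrite normrM (norm_prim_root _ zetaP) mulr1 normr_nat.
rewrite -natr_sum ler_nat.
have : (\sum_(n < p) (A - size (s n)) + \sum_(n < p) size (s n) = p * A)%N.
  rewrite -big_split /= (eq_bigr (fun=> A)) ?sum_nat_const ?card_ord // => n _.
  by rewrite subnK.
rewrite tot /A mulnDr -expnS -addnS => /eqP.
by rewrite addnC eqn_add2l => /eqP->.
Qed.

End ExpsumBound.

(** * Growth of power sums *)

Section Growth.
Variable R : realType.
Local Notation C := R[i].

(** Both numbers are real; Bernoulli's inequality and the archimedean property conclude. *)
Lemma expr_unbounded (x y : C) : 1 < x -> y \is Num.real -> exists n, y < x ^+ n.
Proof.
move=> x1 /complex_realP[b ->]; have /complex_realP[a xa] : x \is Num.real.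
  by apply: ger0_real; apply: le_trans ler01 (ltW x1).
move: x1; rewrite xa -(rmorph1 (real_complex R)) ltcR => a1.
have [n bn] : exists n : nat, b < a ^+ n.
  have d0 : 0 < a - 1 by rewrite subr_gt0.
  exists (Num.bound (`|b| / (a - 1))).
  set n := Num.bound _; have hn : `|b| / (a - 1) < n%:R by apply: archi_boundP;
    rewrite divr_ge0 // ltW.
  rewrite ltr_pdivrMr // in hn.
  apply: (le_lt_trans (ler_norm b)); apply: (lt_le_trans hn).
  elim: (n) => [|k IH]; first by rewrite mul0r expr0.
  rewrite exprS; apply: (@le_trans _ _ (a ^+ k + (a - 1))).
    by rewrite -natr1 mulrDl mul1r lerD2r.
  have ak : 1 <= a ^+ k by apply: exprn_ege1; apply: ltW.
  have E : a * a ^+ k - (a ^+ k + (a - 1)) = (a - 1) * (a ^+ k - 1) by ring.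
  rewrite -subr_ge0 E.
  by rewrite mulr_ge0 ?subr_ge0 // ltW.
by exists n; rewrite -rmorphXn ltcR.
Qed.

(* Combining shifts of the power sums with the coefficients of h isolates the
   contribution of z. *)
Lemma powersum_growth (rs : seq C) (A b : C) : 0 < b ->
  (forall k, `|powersum rs k.+1| <= A * b ^+ k.+1) ->
  {in rs, forall z, `|z| <= b}.
Proof.
move=> b0 H z zrs; have bR := gtr0_real b0.
have [//|bz] := real_leP (normr_real z) bR.
pose h := \prod_(y <- rem z (undup rs)) ('X - y%:P).
have hz : h.[z] != 0.
  rewrite -/(root h z) root_prod_XsubC; apply: contraT; rewrite negbK.
  by rewrite mem_rem_uniq ?undup_uniq // !inE eqxx.
pose N := (count_mem z rs)%:R : C.
have N0 : N != 0 by rewrite pnatr_eq0 -lt0n -has_count has_pred1.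
have sumE k : \sum_(j < size h) h`_j * powersum rs (j + k.+1) = N * (z ^+ k.+1 * h.[z]).
  transitivity (\sum_(x <- rs) x ^+ k.+1 * h.[x]).
    under [RHS]eq_bigr => x _ do rewrite horner_coef mulr_sumr.
    rewrite exchange_big; apply: eq_bigr => j _; rewrite mulr_sumr.
    by apply: eq_bigr => x _; rewrite exprD; ring.
  rewrite (bigID (pred1 z)) /= addrC big_seq_cond big1 => [|x /andP[xrs xz]]; last first.
    have : root h x by rewrite root_prod_XsubC mem_rem_uniq ?undup_uniq // !inE xz
      mem_undup.
    by move/rootP->; rewrite mulr0.
  rewrite add0r (eq_bigr (fun=> z ^+ k.+1 * h.[z])) => [|x /eqP-> //].
  by rewrite big_const_seq iter_addr_0 mulr_natl.
pose B := \sum_(j < size h) `|h`_j| * A * b ^+ j.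
pose c := `|N * h.[z]|.
have c0 : 0 < c by rewrite normr_gt0 mulf_neq0.
have bound k : c * `|z| ^+ k.+1 <= B * b ^+ k.+1.
  rewrite /c -normrX -normrM -mulrA [h.[z] * _]mulrC.
  rewrite -sumE (le_trans (ler_norm_sum _ _ _)) // mulr_suml ler_sum // => j _.
  by rewrite normrM -!mulrA ler_wpM2l // -exprD addnS H.
have t1 : 1 < `|z| / b by rewrite ltr_pdivlMr // mul1r.
have A0 : 0 <= A.
  by have := le_trans (normr_ge0 _) (H 0); rewrite pmulr_lge0 // exprn_gt0.
have B0 : 0 <= B.
  by apply: sumr_ge0 => j _; rewrite !mulr_ge0 // exprn_ge0 // ltW.
(* Some power of |z| / b exceeds [B / c], which contradicts [bound]. *)
have [n] := expr_unbounded t1 (ger0_real (divr_ge0 B0 (ltW c0))).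
rewrite ltr_pdivrMr // => lt.
have : B < B.
  apply: (lt_le_trans lt); apply: (@le_trans _ _ ((`|z| / b) ^+ n.+1 * c)).
    by rewrite ler_wpM2r ?ler_weXn2l // ltW.
  by rewrite mulrC expr_div_n mulrA ler_pdivrMr ?exprn_gt0.
by rewrite ltxx.
Qed.
End Growth.

(** The sum is [expsum] at k = 1, that is, minus a sum of [D.-1] numbers of modulus at most sqrt p.
    The condition D < p makes [D] prime to [p]. *)
Theorem weil_bound (R : realType) (p : nat) (zeta : R[i]) (g : {poly 'F_p}) (D : nat) :
  prime p -> p.-primitive_root zeta -> size g = D.+1 -> (0 < D < p)%N ->
  `|\sum_(a : 'F_p) zeta ^+ g.[a]| <= (D.-1)%:R * real_complex R (Num.sqrt p%:R).
Proof.
move=> p_pr zP sg /andP[D0 Dp].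
have [K [iota _]] := countable_algebraic_closure 'F_p.
have charKp : p \in [pchar K] by rewrite (fmorph_pchar iota) pchar_Fp.
have iotaE a : iota a = (a : nat)%:R by rewrite -{1}(natr_Zp a) rmorph_nat.
have fermat (a : 'F_p) : a ^+ p = a.
  by have := expf_card a; rewrite card_Fp.
pose f := map_poly iota g.
have fixf : fixedp charKp f.
  apply/eqP/polyP => i; rewrite !coef_map /= pFrobenius_autE -rmorphXn.
  by rewrite fermat.
have sf : size f = D.+1 by rewrite size_map_poly.
have coDp : coprime p D by rewrite prime_coprime // gtnNdvd.
have [rs srs E] := expsum_roots zP fixf sf D0 coDp.
have sumE : expsum p zeta f 1 = \sum_(a : 'F_p) zeta ^+ g.[a].
  rewrite /expsum (perm_big (map iota (enum 'F_p))); last first.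
    have u : uniq (map iota (enum 'F_p)).
      by rewrite map_inj_uniq ?enum_uniq //; apply: fmorph_inj.
    have sub : {subset map iota (enum 'F_p) <= Fq K p 1}.
      by move=> _ /mapP[a _ ->]; rewrite mem_Fq // expn1 -rmorphXn fermat.
    apply: uniq_perm => //; first exact: uniq_Fq.
    have [|_ e] := uniq_min_size u sub; last by move=> x; rewrite e.
    by rewrite (size_Fq charKp) // size_map -cardE card_Fp ?expn1.
  rewrite big_map big_enum; apply: eq_bigr => a _.
  by rewrite /powtrace big_ord1 expr1 horner_map iotaE (addchar_nat charKp zP).
rewrite -sumE E normrN.
have p0 : 0 < p%:R :> R[i] by rewrite ltr0n prime_gt0.
have small z : z \in rs -> `|z| <= real_complex R (Num.sqrt p%:R).
  move=> zrs; suff : `|z ^+ 2| <= p%:R.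
    rewrite normrX -[X in _ <= X]/(p%:R) (_ : p%:R = real_complex R (Num.sqrt p%:R) ^+ 2).
      by rewrite ler_pXn2r // nnegrE // ler0c sqrtr_ge0.
    by rewrite -rmorphXn sqr_sqrtr ?ler0n // rmorph_nat.
  (* [expsum_le] controls even exponents only, so the growth lemma is applied to the squares, with
     ratio [p]. *)
  apply: (@powersum_growth R [seq x ^+ 2 | x <- rs] ((p * (2 * D + 1))%:R) _ p0);
    last exact: map_f.
  move=> m; rewrite -natrX -natrM -mulnA.
  apply: le_trans _ (expsum_le zP fixf sf D0 coDp m).
  rewrite E normrN /powersum big_map le_eqVlt; apply/orP; left; apply/eqP; congr `|_|.
  by apply: eq_bigr => x _; rewrite -exprM mul2n -addnn.
rewrite /powersum (le_trans (ler_norm_sum _ _ _)) //.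
rewrite -srs -sum1_size natr_sum mulr_suml big_seq [X in _ <= X]big_seq ler_sum // => z zrs.
by rewrite expr1 mul1r small.
Qed.

Local Open Scope complex_scope.

(** * Sums of products of cosines *)

(** [acos] inverts [cos] only on [0, pi], but cos (n y) is a Chebyshev polynomial in cos y: the
    recurrence [step] involves [y] only through such cosines. *)
Lemma cos_mul_acos (R : realType) (n : nat) (x : R) :
  cos (n%:R * acos (cos x)) = cos (n%:R * x).
Proof.
have cc : cos (acos (cos x)) = cos x.
  by apply: acosK; rewrite in_itv /= cos_geN1 cos_le1.
have step k (y : R) : cos (k.+2%:R * y) = 2 * cos y * cos (k.+1%:R * y) - cos (k%:R * y).
  have -> : k.+2%:R * y = k.+1%:R * y + y by rewrite -[k.+2%:R]natr1 mulrDl mul1r.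
  have -> : k%:R * y = k.+1%:R * y - y by rewrite -[k.+1%:R]natr1 mulrDl mul1r addrK.
  by rewrite cosB cosD; ring.
suff : cos (n%:R * acos (cos x)) = cos (n%:R * x) /\
    cos (n.+1%:R * acos (cos x)) = cos (n.+1%:R * x) by case.
elim: n => [|n [IH1 IH2]]; first by rewrite !mul0r !mul1r.
by rewrite !step cc IH1 IH2.
Qed.

(** Reflection maps 1, ..., h onto h+1, ..., 2h; the index 0 has no partner and is added once
    more. *)
Lemma half_sum (A : comNzRingType) (g : nat -> A) h :
  (forall j, (0 < j <= h)%N -> g (h.*2.+1 - j)%N = g j) ->
  g 0 + \sum_(j < h.*2.+1) g j = (\sum_(j < h.+1) g j) *+ 2.
Proof.
move=> gs; rewrite -(big_mkord xpredT g) (@big_cat_nat _ _ _ h.+1) //=; last by lia.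
rewrite addrCA mulr2n -(big_mkord xpredT g); congr (_ + _).
rewrite big_nat_rev [RHS]big_nat_recl //=; congr (_ + _).
rewrite -[X in \sum_(X <= _ < _) _]add0n big_addn (_ : (h.*2.+1 - h.+1 = h)%N); last by lia.
rewrite !big_nat; apply: eq_bigr => j /andP[_ jh].
by rewrite -(gs j.+1) ?jh //; congr g; lia.
Qed.

Lemma card_bool_ffun d : #|{ffun 'I_d -> bool}| = (2 ^ d)%N.
Proof. by rewrite card_ffun card_bool card_ord. Qed.

(** * Additive characters of F_M and sums of cosines *)

Section Characters.
Variables (R : realType) (M : nat).
Hypotheses (M_pr : prime M) (M_gt2 : (2 < M)%N).
Local Notation C := R[i].

Definition zetaM : C := cos (2 * pi / M%:R) +i* sin (2 * pi / M%:R).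

Lemma zetaMX n : zetaM ^+ n = cos (2 * pi * n%:R / M%:R) +i* sin (2 * pi * n%:R / M%:R).
Proof.
elim: n => [|n IH]; first by rewrite mulr0 mul0r cos0 sin0.
have -> : 2 * pi * n.+1%:R / M%:R = 2 * pi / M%:R + 2 * pi * n%:R / M%:R :> R.
  by rewrite -natr1; ring.
by rewrite exprS IH cosD sinD; congr (_ +i* _); ring.
Qed.

(** The order divides the prime [M], and it is not 1 because sin (2 pi / M) > 0. *)
Lemma zetaM_prim : M.-primitive_root zetaM.
Proof.
have M0 : M%:R != 0 :> R by rewrite pnatr_eq0; lia.
have zM : zetaM ^+ M = 1.
  by rewrite zetaMX mulfK // mulr_natl cos2pi sin2pi.
have [m mz] := prim_order_exists (prime_gt0 M_pr) zM.
case/primeP: (M_pr) => _ dvM /dvM /orP[/eqP m1|/eqP<- //].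
have := prim_expr_order mz; rewrite m1 expr1 => z1.
have : 0 < sin (2 * pi / M%:R : R).
  apply: sin_gt0_pi; rewrite divr_gt0 ?mulr_gt0 ?pi_gt0 ?ltr0n ?prime_gt0 //=.
  rewrite ltr_pdivrMr ?ltr0n ?prime_gt0 // mulrC ltr_pM2l ?pi_gt0 //.
  by rewrite ltr_nat.
by move: z1 => [_ ->]; rewrite ltxx.
Qed.

Definition psi (a : 'F_M) : C := zetaM ^+ a.

Lemma psi_nat n : psi n%:R = zetaM ^+ n.
Proof. by rewrite /psi val_Fp_nat // (prim_expr_mod zetaM_prim). Qed.

Lemma psiD a b : psi (a + b) = psi a * psi b.
Proof. by rewrite -[a]natr_Zp -[b]natr_Zp -natrD !psi_nat exprD. Qed.

Lemma psi0 : psi 0 = 1.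
Proof. exact: (psi_nat 0). Qed.

Lemma norm_psi a : `|psi a| = 1.
Proof. exact: norm_prim_root zetaM_prim. Qed.

Lemma psiN a : psi (- a) = (psi a)^*.
Proof.
have E : psi (- a) * psi a = 1 by rewrite -psiD addNr psi0.
have p0 : psi a != 0 by rewrite -normr_gt0 norm_psi.
by apply: (mulIf p0); rewrite E mulrC -sqr_normc norm_psi expr1n.
Qed.

Definition cs (a : 'F_M) : R := complex.Re (psi a).

Lemma cs_nat n : cs n%:R = cos (2 * pi * n%:R / M%:R).
Proof. by rewrite /cs psi_nat zetaMX. Qed.

Lemma csE a : (cs a)%:C = (psi a + psi (- a)) / 2.
Proof. by rewrite psiN ReJ_add. Qed.

Lemma csN a : cs (- a) = cs a.
Proof. by apply: complexI; rewrite !csE opprK addrC. Qed.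

Lemma cs0 : cs 0 = 1.
Proof. by rewrite /cs psi0. Qed.

Lemma csM a b : cs a * cs b = (cs (a + b) + cs (a - b)) / 2.
Proof.
apply: complexI; rewrite !(rmorphM, rmorphD, fmorphV, rmorph_nat) /= !csE !opprD opprK
  !psiD.
by field.
Qed.

(** Each cosine is the mean of [psi] at two opposite arguments. Expansion gives a mean over 2^d sign
    patterns of character sums of polynomials of degree at most [d], nonconstant since
    [kap t0 != 0]; Weil's inequality bounds each. *)
Lemma sum_prod_cs_le d (kap : 'I_d -> 'F_M) t0 : (d < M)%N -> kap t0 != 0 ->
  `|\sum_(j : 'F_M) \prod_(t < d) cs (kap t * j ^+ t.+1)| <= (d.-1)%:R * Num.sqrt M%:R.
Proof.
move=> dM k0; set B := (X in _ <= X).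
suff : `|(\sum_(j : 'F_M) \prod_(t < d) cs (kap t * j ^+ t.+1))%:C| <= B%:C.
  by rewrite normc_def /= expr0n /= addr0 sqrtr_sqr lecR.
pose sg (b : bool) (x : 'F_M) := if b then x else - x.
pose f (e : {ffun 'I_d -> bool}) : {poly 'F_M} := \sum_(t < d) sg (e t) (kap t) *:
  'X^(t.+1).
have fE : (\sum_(j : 'F_M) \prod_(t < d) cs (kap t * j ^+ t.+1))%:C =
    2^-1 ^+ d * \sum_(e : {ffun 'I_d -> bool}) \sum_(j : 'F_M) zetaM ^+ (f e).[j].
  rewrite rmorph_sum exchange_big mulr_sumr; apply: eq_bigr => j _ /=.
  have -> : 2^-1 ^+ d = \prod_(t < d) 2^-1 :> C by rewrite prodr_const card_ord.
  rewrite rmorph_prod.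
  transitivity (\prod_(t < d) \sum_(b : bool) 2^-1 * psi (sg b (kap t * j ^+ t.+1))).
    apply: eq_bigr => t _; rewrite /= csE big_bool /= mulrC mulrDr.
    by [].
  rewrite bigA_distr_bigA mulr_sumr; apply: eq_bigr => e _; rewrite big_split /=;
    congr (_ * _).
  rewrite -(big_morph psi psiD psi0) -/(psi _) /f horner_sum; congr psi.
  by apply: eq_bigr => t _; rewrite hornerZ hornerXn /sg; case: (e t); rewrite ?mulNr.
rewrite fE normrM normrX normfV normr_nat.
rewrite exprVn ler_pdivrMl ?exprn_gt0 // -natrX -card_bool_ffun mulr_natl -sumr_const.
apply: (le_trans (ler_norm_sum _ _ _)); apply: ler_sum => e _.
have fc i : (f e)`_i.+1 = if insub i is Some t then sg (e t) (kap t) else 0.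
  rewrite coef_sum; case: insubP => [t _ ti|]; last first.
    rewrite -leqNgt => di; apply: big1 => t _; rewrite coefZ coefXn eqSS gtn_eqF ?mulr0 //.
    exact: leq_trans (ltn_ord t) di.
  rewrite (bigD1 t) //= coefZ coefXn ti eqxx mulr1 big1 ?addr0 // => u ut.
  by rewrite coefZ coefXn eqSS -ti val_eqE eq_sym (negPf ut) mulr0.
have fc0 : (f e)`_0 = 0 by rewrite coef_sum big1 // => t _; rewrite coefZ coefXn mulr0.
have ft0 : (f e)`_t0.+1 != 0.
  by rewrite fc valK /sg; case: (e t0); rewrite ?oppr_eq0.
have sf : (1 < size (f e))%N.
  rewrite ltnNge; apply: contra ft0 => s1; rewrite nth_default //; exact: leq_trans s1 _.
have sfd : (size (f e) <= d.+1)%N.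
  apply: (leq_trans (size_sum _ _ _)); apply/bigmax_leqP => t _.
  by rewrite (leq_trans (size_scale_leq _ _)) // size_polyXn ltnS.
have Dle : ((size (f e)).-1.-1 <= d.-1)%N by lia.
have sfE : size (f e) = (size (f e)).-1.+1 by rewrite prednK //; lia.
have D1 : (0 < (size (f e)).-1 < M)%N by lia.
apply: (le_trans (weil_bound M_pr zetaM_prim sfE D1)).
rewrite -(rmorph_nat (real_complex R)) -rmorphM lecR ler_wpM2r ?sqrtr_ge0 // ler_nat //.
Qed.

End Characters.

(** * Coherence and sparse recovery *)

Section Gram.
Variables (R : realType) (d q M : nat).
Hypotheses (M_pr : prime M) (M_gt2 : (2 < M)%N) (dM : (d < M)%N) (qM : (2 * q < M)%N).

Definition gram (n n' : Lam q d) : R := \sum_(j < msz M) AP R M q d j n * AP R M q d j n'.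

(** The values of Phi_n at the sample points, extended to all j in F_M. *)
Definition phi (n : Lam q d) (j : 'F_M) : R := \prod_(t < d) cs R ((n t)%:R * j ^+ t.+1).

Lemma APE n (j : nat) : Phi R q d n (xpt R M d j) = phi n j%:R.
Proof.
apply: eq_bigr => t _; rewrite /xpt cos_mul_acos -natrX -natrM cs_nat //.
by rewrite /ppt natrM; congr cos; ring.
Qed.

Lemma phiN n j : phi n (- j) = phi n j.
Proof.
apply: eq_bigr => t _; rewrite exprNn mulrCA -signr_odd.
by case: (odd _); rewrite ?expr1 ?mulN1r ?csN // expr0 mul1r.
Qed.

Lemma phi0 n : phi n 0 = 1.
Proof. by apply: big1 => t _; rewrite expr0n mulr0 cs0. Qed.

(** The sample points use half of F_M. Evenness of [phi] completes the sum; the extra 1 is the term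
    j = 0 counted twice. *)
Lemma gramE n n' : gram n n' = (1 + \sum_(j : 'F_M) phi n j * phi n' j) / 2.
Proof.
have Mh : M = (M./2).*2.+1.
  have := odd_double_half M; case: (even_prime M_pr) => [M2|->]; last by [].
  by move: M_gt2; rewrite M2.
pose g (j : nat) := phi n j%:R * phi n' j%:R.
have gs j : (0 < j <= M./2)%N -> g ((M./2).*2.+1 - j)%N = g j.
  move=> /andP[j0 jh]; rewrite -Mh /g natrB; last by rewrite Mh; lia.
  by rewrite (pchar_Fp_0 M_pr) sub0r (phiN n) (phiN n').
have := half_sum gs; rewrite -Mh => E.
have gg : gram n n' = \sum_(j < (M./2).+1) g j.
  by apply: eq_bigr => j _; rewrite /AP !APE.
have -> : \sum_(j : 'F_M) phi n j * phi n' j = \sum_(j < M) g j.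
  transitivity (\sum_(0 <= j < (Zp_trunc (pdiv M)).+2) g j);
    last by rewrite (Fp_cast M_pr) big_mkord.
  rewrite big_mkord.
  by apply: eq_bigr => j _; rewrite /g natr_Zp.
have g0 : g 0%N = 1 by rewrite /g !phi0 mulr1.
by rewrite g0 in E; rewrite E gg -[(\sum_(_ < _) _) *+ 2]mulr_natr mulfK ?pnatr_eq0.
Qed.

(** Frequencies from cos a cos b = (cos (a + b) + cos (a - b)) / 2, one choice of sign per
    coordinate. *)
Let kap (n n' : Lam q d) (e : {ffun 'I_d -> bool}) (t : 'I_d) : 'F_M :=
  if e t then (n t)%:R + (n' t)%:R else (n t)%:R - (n' t)%:R.

Lemma sum_phiE n n' : \sum_(j : 'F_M) phi n j * phi n' j =
  2^-1 ^+ d * \sum_(e : {ffun 'I_d -> bool}) \sum_(j : 'F_M) \prod_(t < d) cs R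
    (kap n n' e t * j ^+ t.+1).
Proof.
rewrite exchange_big mulr_sumr; apply: eq_bigr => j _ /=.
have -> : 2^-1 ^+ d = \prod_(t < d) 2^-1 :> R by rewrite prodr_const card_ord.
rewrite -big_split /=.
transitivity (\prod_(t < d) \sum_(b : bool) 2^-1 *
    cs R ((if b then (n t)%:R + (n' t)%:R else (n t)%:R - (n' t)%:R) * j ^+ t.+1)).
  apply: eq_bigr => t _; rewrite /= csM // big_bool /= mulrC mulrDr.
  by rewrite mulrDl mulrBl.
by rewrite bigA_distr_bigA mulr_sumr; apply: eq_bigr => e _; rewrite big_split.
Qed.

Let W : R := (d.-1)%:R * Num.sqrt M%:R.

Let natr_eq0 k : ((k%:R : 'F_M) == 0) = (M %| k)%N.
Proof. by rewrite -(dvdn_pcharf (pchar_Fp M_pr)). Qed.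

(** Where n and n' differ, n_t + n'_t and n_t - n'_t are nonzero of absolute value at most 2 q < M,
    so every sign pattern has a nonzero frequency. *)
Lemma gram_offdiag n n' : n != n' -> `|gram n n'| <= (1 + W) / 2.
Proof.
move=> nn'; have [t nt] : exists t, n t != n' t.
  apply/existsP; apply: contraNT nn' => /existsPn H; apply/eqP/ffunP => t.
  by apply/eqP; rewrite -[_ == _]negbK H.
have k0 e : kap n n' e t != 0.
  have ab_neq0 (a b : nat) : (a <= q)%N -> (b < a)%N ->
      (a%:R + b%:R != 0 :> 'F_M) /\ (a%:R - b%:R != 0 :> 'F_M).
    move=> aq ba; rewrite -natrD -natrB ?natr_eq0; last exact: ltnW.
    by rewrite !gtnNdvd //; lia.
  have := nt; rewrite -val_eqE /= /kap neq_ltn => /orP[] lt.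
    have [D B] := ab_neq0 _ _ (ltn_ord (n' t)) lt.
    by case: (e t); [rewrite addrC|rewrite -opprB oppr_eq0].
  by have [D B] := ab_neq0 _ _ (ltn_ord (n t)) lt; case: (e t).
rewrite gramE normrM [`|2^-1|]ger0_norm ?invr_ge0 // ler_wpM2r ?invr_ge0 //.
apply: (le_trans (ler_normD _ _)); rewrite normr1 lerD2l sum_phiE.
rewrite normrM ger0_norm ?exprn_ge0 ?invr_ge0 // exprVn ler_pdivrMl ?exprn_gt0 //.
rewrite -natrX -card_bool_ffun mulr_natl -sumr_const.
apply: (le_trans (ler_norm_sum _ _ _)); apply: ler_sum => e _.
exact: sum_prod_cs_le (k0 e).
Qed.

(** The pattern of all differences has zero frequencies and contributes [M]; every other pattern
    contributes at least [- W]. *)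
Lemma gram_diag n : (1 + 2^-1 ^+ d * M%:R - W) / 2 <= gram n n.
Proof.
rewrite gramE ler_wpM2r ?invr_ge0 // -addrA lerD2l sum_phiE.
have W0 : 0 <= W by rewrite mulr_ge0 ?ler0n ?sqrtr_ge0.
have kap0 e : (forall t, kap n n e t = 0) ->
    \sum_(j : 'F_M) \prod_(t < d) cs R (kap n n e t * j ^+ t.+1) = M%:R.
  move=> k0; rewrite (eq_bigr (fun=> 1)) => [|j _].
    by rewrite sumr_const card_Fp.
  by apply: big1 => t _; rewrite k0 mul0r cs0.
(* Zero coordinates of [n] produce further patterns with only zero frequencies; their sum [M] is
   nonnegative. *)
have ge e : - W <= \sum_(j : 'F_M) \prod_(t < d) cs R (kap n n e t * j ^+ t.+1).
  have [/forallP k0|/forallPn[t k0]] := boolP [forall t, kap n n e t == 0].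
    by rewrite kap0 => [|t]; [rewrite (le_trans _ (ler0n _ _)) // oppr_le0|apply/eqP].
  have := sum_prod_cs_le R M_pr M_gt2 dM k0; rewrite ler_norml => /andP[+ _]; exact.
rewrite (bigD1 [ffun=> false]) //= kap0 => [|t]; last by rewrite /kap ffunE subrr.
rewrite mulrDr lerD2l.
have le1 : - W *+ 2 ^ d <= \sum_(e | e != [ffun=> false]) \sum_(j : 'F_M) \prod_(t < d)
  cs R (kap n n e t * j ^+ t.+1).
  rewrite -card_bool_ffun -sumr_const (bigD1 [ffun=> false]) //= -[leRHS]add0r lerD
    ?oppr_le0 //.
  by apply: ler_sum => e _; apply: ge.
rewrite exprVn ler_pdivlMl ?exprn_gt0 // -natrX mulr_natl; exact: le1.
Qed.

(** The lower bound on [M] says 3 2^d d s <= sqrt M, so that the main term 2^-d M of the diagonal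
    dominates 3 s W. *)
Lemma gram_coherence (s : nat) n n' m : (0 < d)%N -> (0 < s)%N ->
  (9 * 4 ^ d * d ^ 2 * s ^ 2 <= M)%N -> n != n' ->
  (3 * s%:R - 1) * `|gram n n'| <= gram m m.
Proof.
move=> d0 s0 bM nn'; set r := Num.sqrt (M%:R : R).
have r0 : 0 <= r by apply: sqrtr_ge0.
have rr : r ^+ 2 = M%:R by rewrite sqr_sqrtr ?ler0n.
have rlow : 3 * 2 ^+ d * d%:R * s%:R <= r.
  rewrite -(@ler_pXn2r _ 2) ?nnegrE ?mulr_ge0 ?exprn_ge0 ?ler0n //.
  have E4 : (4 ^ d = (2 ^ d) ^ 2)%N by rewrite -expnM mulnC expnM.
  rewrite rr -!natrX -!natrM -natrX ler_nat.
  by move: bM; rewrite E4 !expnMn.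
have s1 : 1 <= s%:R :> R by rewrite ler1n.
have d1 : 1 <= d%:R :> R by rewrite ler1n.
have e1 : 1 <= 2 ^+ d :> R by rewrite exprn_ege1 // ler1n.
apply: le_trans (gram_diag m); apply: (@le_trans _ _ ((3 * s%:R - 1) * ((1 + W) / 2))).
  by rewrite ler_wpM2l ?gram_offdiag //; lra.
have WE : W = (d%:R - 1) * r by rewrite /W -/r -subn1 natrB.
rewrite WE -rr mulrA ler_wpM2r ?invr_ge0 //.
set D := d%:R in rlow d1 *; set S := s%:R in rlow s1 *.
have key : 3 * D * S * r <= 2^-1 ^+ d * r ^+ 2.
  rewrite exprVn ler_pdivlMl ?exprn_gt0 // expr2 mulrA ler_wpM2r //.
  by apply: le_trans rlow; rewrite le_eqVlt; apply/orP; left; apply/eqP; ring.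
have r1 : 1 <= r.
  have DS : 1 <= D * S by rewrite -[X in X <= _]mulr1 ler_pM.
  apply: le_trans rlow; rewrite -mulrA -[X in X <= _]mulr1 ler_pM //.
  by move: e1; set P := 2 ^+ d => e1; lra.
(* Rearranged, the claim is 3 s (1 + (d - 1) r) <= 2 + 2^-d r^2, which follows from [key] and
   [r1]. *)
nra.
Qed.
End Gram.

(** * Sparse recovery from low coherence *)

Section SparseRecovery.
Variables (R : realType) (T : finType).
Implicit Types (x h z : T -> R[i]).

Lemma normC_cmod (z : R[i]) : `|z| = (cmod R z)%:C.
Proof. by case: z. Qed.

Lemma cmod_ge0 (z : R[i]) : 0 <= cmod R z.
Proof. by rewrite -lecR -normC_cmod normr_ge0. Qed.

Lemma cmodN (z : R[i]) : cmod R (- z) = cmod R z.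
Proof. by apply: complexI; rewrite -!normC_cmod normrN. Qed.

Lemma cmodD (y z : R[i]) : cmod R (y + z) <= cmod R y + cmod R z.
Proof. by rewrite -lecR rmorphD /= -!normC_cmod ler_normD. Qed.

(** Coordinate [n] of B^T B h = 0 expresses h_n through the other h_n' with coefficients at most 1 /
    mu; adding |h_n| to both sides turns [mu] into [mu + 1]. *)
Lemma kernel_coherence (m : nat) (B : 'I_m -> T -> R) (mu : R) h :
  0 < mu ->
  (forall n, \sum_j B j n ^+ 2 = 1) ->
  (forall n n', n != n' -> mu * `|\sum_j B j n * B j n'| <= 1) ->
  (forall j, \sum_n (B j n)%:C * h n = 0) ->
  forall n, (mu + 1) * cmod R (h n) <= l1norm R T h.
Proof.
move=> mu0 B1 Bmu Bh n; pose G n' := \sum_j B j n * B j n'.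
have E : \sum_n' (G n')%:C * h n' = 0.
  transitivity (\sum_j (B j n)%:C * \sum_n' (B j n')%:C * h n').
    under [RHS]eq_bigr => j _ do rewrite mulr_sumr.
    rewrite exchange_big; apply: eq_bigr => n' _.
    rewrite rmorph_sum mulr_suml; apply: eq_bigr => j _.
    by rewrite rmorphM mulrA.
  by rewrite big1 // => j _; rewrite Bh mulr0.
have Gn : G n = 1 by rewrite /G -(B1 n); apply: eq_bigr => j _; rewrite expr2.
move: E; rewrite (bigD1 n) //= Gn mul1r => /eqP; rewrite addr_eq0 => /eqP hn.
rewrite /l1norm (bigD1 n) //= mulrDl mul1r [leLHS]addrC lerD2l.
rewrite -lecR rmorphM /= -normC_cmod hn normrN.
apply: (@le_trans _ _ (mu%:C * \sum_(n' | n' != n) `|(G n')%:C * h n'|)).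
  by rewrite ler_wpM2l ?ler_norm_sum // ler0c ltW.
rewrite mulr_sumr rmorph_sum; apply: ler_sum => n' nn' /=.
rewrite normrM mulrA -normC_cmod -[leRHS]mul1r ler_wpM2r //.
have -> : `|(G n')%:C| = `|G n'|%:C by rewrite normc_def /= expr0n /= addr0 sqrtr_sqr.
by rewrite -rmorphM /= -(rmorph1 (real_complex R)) lecR Bmu // eq_sym.
Qed.

(** With P the support of [z], the norm of h is at most twice that of h on P plus twice that of x -
    z. The part on P has at most [s] terms, hence at most a third of the norm of h. *)
Lemma l1_recovery (s : nat) x h z : (0 < s)%N ->
  (forall n, 3 * s%:R * cmod R (h n) <= l1norm R T h) ->
  l1norm R T (fun n => x n + h n) <= l1norm R T x ->
  (#|[pred i | z i != 0%R]| <= s)%N ->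
  l1norm R T h <= 6 * l1norm R T (fun n => x n - z n).
Proof.
move=> s0 hs xh zs; pose P := [pred i | z i != 0].
(* On the support, |x| <= |x + h| + |h|; off it, x - z = x and |h| <= |x + h| + |x|. *)
have pt n : cmod R (h n) - 2 * (if P n then cmod R (h n) else 0) - 2 * cmod R (x n - z n)
    <= cmod R (x n + h n) - cmod R (x n).
  rewrite inE; case: eqP => [->|_] /=.
    rewrite subr0; have := cmodD (x n + h n) (- x n); rewrite addrAC subrr add0r cmodN.
    by lra.
  have := cmodD (x n + h n) (- h n); rewrite addrK cmodN.
  by have := cmod_ge0 (x n - z n); lra.
have : \sum_n (cmod R (h n) - 2 * (if P n then cmod R (h n) else 0) - 2 * cmod R
  (x n - z n)) <= 0.
  apply: (le_trans (ler_sum _ (fun n _ => pt n))); rewrite sumrB subr_le0; exact: xh.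
rewrite !sumrB -!mulr_sumr -big_mkcond /= -/(l1norm R T h)
  -/(l1norm R T (fun n => x n - z n)).
set L := l1norm R T h in hs *.
have L0 : 0 <= L by apply: sumr_ge0 => n _; apply: cmod_ge0.
have sR : 0 < s%:R :> R by rewrite ltr0n.
have : \sum_(n | P n) cmod R (h n) <= L / 3.
  apply: (@le_trans _ _ (\sum_(n | P n) L / (3 * s%:R))).
    by apply: ler_sum => n _; rewrite ler_pdivlMr ?mulr_gt0 // mulrC hs.
  rewrite sumr_const -[leLHS]mulr_natr (_ : L / 3 = L / (3 * s%:R) * s%:R).
    by rewrite ler_wpM2l ?divr_ge0 ?mulr_ge0 ?ler0n // ler_nat.
  by field; rewrite gt_eqF.
set X := \sum_(n | _) _; set Y := l1norm _ _ _; lra.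
Qed.

(** The squared l2 norm is at most the largest |h_n| times the l1 norm. *)
Lemma l2_le_l1 (s : nat) h : (0 < s)%N ->
  (forall n, 3 * s%:R * cmod R (h n) <= l1norm R T h) ->
  l2norm R T h <= l1norm R T h / Num.sqrt s%:R.
Proof.
move=> s0 hs; set L := l1norm R T h in hs *.
have L0 : 0 <= L by apply: sumr_ge0 => n _; apply: cmod_ge0.
have sR : 0 < s%:R :> R by rewrite ltr0n.
rewrite -[leRHS]ger0_norm ?divr_ge0 ?sqrtr_ge0 // -sqrtr_sqr ler_wsqrtr //.
rewrite expr_div_n sqr_sqrtr ?ler0n // expr2 mulrAC /L {2}/l1norm mulr_sumr.
apply: ler_sum => n _; rewrite expr2 ler_wpM2r ?cmod_ge0 // ler_pdivlMr // mulrC.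
by apply: le_trans (hs n); have := cmod_ge0 (h n); nra.
Qed.
End SparseRecovery.

Theorem theorem3 (R : realType) (d q s M : nat) :
  (0 < d)%N -> (0 < q)%N -> (0 < s)%N -> prime M ->
  (2 * q + 1 <= M)%N -> (9 * 4 ^ d * d ^ 2 * s ^ 2 <= M)%N ->
  exists K : R, 0 < K /\
    forall (c csharp : Lam q d -> R[i]),
      (forall j, Amul R M q d csharp j = bvec R M q d c j) ->
      (forall z : Lam q d -> R[i],
          (forall j, Amul R M q d z j = bvec R M q d c j) -> l1norm R _ csharp <= l1norm R _ z) ->
      l2norm R _ (fun n => csharp n - ctil R M q d c n)
        <= K * sigma1 R _ s (ctil R M q d c) / Num.sqrt (s%:R).
Proof.
(* The constant of [l1_recovery]; passing to the l2 norm only brings in 1 / sqrt s. *)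
move=> d0 q0 s0 M_pr qM bM; exists 6; split=> // c csharp cfeas cmin.
have s1 : 1 <= s%:R :> R by rewrite ler1n.
have dM : (d < M)%N.
  apply: leq_trans bM; apply: leq_trans (ltn_expl d (isT : (1 < 4)%N)) _.
  by rewrite [X in (X * _ * _)%N]mulnC -!mulnA leq_pmulr // !muln_gt0 d0 s0.
have M_gt2 : (2 < M)%N by lia.
have qM' : (2 * q < M)%N by lia.
(* At j = 0 every Phi_n equals 1, so no column vanishes and [Cdiag] is a true inverse. *)
have diag_gt0 (n : Lam q d) : 0 < gram R M n n.
  rewrite /gram big_ord_recl ltr_pwDl //.
    rewrite /AP !APE // phi0 // mulr1; exact: ltr01.
  by apply: sumr_ge0 => j _; rewrite -expr2 sqr_ge0.
have CdE n : Cdiag R M q d n = (Num.sqrt (gram R M n n))^-1.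
  by rewrite /Cdiag /gram; congr (Num.sqrt _)^-1.
have Cd_gt0 n : 0 < Cdiag R M q d n by rewrite CdE invr_gt0 sqrtr_gt0.
have Cd_ge0 n := ltW (Cd_gt0 n).
have diag_ge0 n := ltW (diag_gt0 n).
have AmatE n n' : \sum_j Amat R M q d j n * Amat R M q d j n' =
    gram R M n n' * (Cdiag R M q d n * Cdiag R M q d n').
  by rewrite /gram mulr_suml; apply: eq_bigr => j _; rewrite /Amat; ring.
pose x := ctil R M q d c; pose h n := csharp n - x n.
have xfeas j : Amul R M q d x j = bvec R M q d c j.
  rewrite /Amul /bvec /fexp; apply: eq_bigr => n _; rewrite /x /ctil /Amat /AP rmorphM /=.
  have C0 : (Cdiag R M q d n)%:C != 0 :> R[i].
    by rewrite -(rmorph0 (real_complex R)) (inj_eq (@complexI R)) gt_eqF.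
  by field.
have hker j : \sum_n (Amat R M q d j n)%:C * h n = 0.
  rewrite /h; under eq_bigr => n _ do rewrite mulrBr.
  by rewrite sumrB -/(Amul R M q d csharp j) -/(Amul R M q d x j) cfeas xfeas subrr.
have hle n : 3 * s%:R * cmod R (h n) <= l1norm R _ h.
  have -> : 3 * s%:R = (3 * s%:R - 1) + 1 :> R by rewrite subrK.
  apply: (kernel_coherence _ _ _ hker); first by lra.
    move=> n'; under eq_bigr => j _ do rewrite expr2.
    rewrite AmatE CdE -expr2 exprVn sqr_sqrtr ?mulfV ?gt_eqF //; exact: ltW.
  move=> n1 n2 n12; rewrite AmatE normrM [`|_ * Cdiag _ _ _ _ _|]ger0_norm ?mulr_ge0 //.
  rewrite mulrA !CdE -invfM ler_pdivrMr ?mulr_gt0 ?sqrtr_gt0 // mul1r.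
  (* Taken at [n1] and [n2] and multiplied, the bound yields the geometric mean that the
     normalisation asks for. *)
  have key m := gram_coherence R M_pr M_gt2 dM qM' m d0 s0 bM n12.
  set u := _ * `|_| in key *.
  have u0 : 0 <= u by rewrite mulr_ge0 //; lra.
  have v0 := mulr_ge0 (sqrtr_ge0 (gram R M n1 n1)) (sqrtr_ge0 (gram R M n2 n2)).
  rewrite -(@ler_pXn2r _ 2) ?nnegrE // [leRHS]exprMn !sqr_sqrtr //.
  by rewrite expr2 ler_pM.
apply: (le_trans (l2_le_l1 s0 hle)).
rewrite ler_wpM2r ?invr_ge0 ?sqrtr_ge0 //.
(* It suffices to treat each s-sparse [z]; the zero vector shows that the set is nonempty. *)
rewrite -ler_pdivrMl //; apply: lb_le_inf.
  by exists (l1norm R _ (fun i => x i - 0)); exists (fun=> 0); split=> //;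
    rewrite eq_card0 // => i; rewrite inE eqxx.
move=> r [z [zs ->]]; rewrite ler_pdivrMl //; apply: (l1_recovery s0 hle) zs.
apply: le_trans (cmin x xfeas); rewrite le_eqVlt; apply/orP; left; apply/eqP.
by apply: eq_bigr => n _; rewrite /h addrC subrK.
Qed.
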